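(* Let $(R,\mathfrak m)$ be a two-dimensional Cohen–Macaulay local ring with infinite residue field, $I$ an $\mathfrak m$-primary ideal, and $x\in I$ a superficial element for $I$. If $\operatorname{n}(I)\neq\rho(I)-1$, then $\operatorname{rd}(I)\ge\operatorname{n}(I)+2$.
   Context: $H_I(n)=\lambda(R/I^n)$ is the Hilbert–Samuel function, $P_I$ the Hilbert–Samuel polynomial, and $\operatorname{n}(I)=\min\{n\in\mathbb Z:P_I(t)=H_I(t)\text{ for all }t>n\}$ the postulation number. The Ratliff–Rush closure of an ideal $K$ is $\widetilde K=\bigcup_{n\ge1}(K^{n+1}:K^n)$, and $\rho(I)=\min\{i\ge1:\widetilde{I^n}=I^n\text{ for all }n\ge i\}$. A reduction of $I$ is an ideal $J\subseteq I$ with $JI^n=I^{n+1}$ for some $n$; $\operatorname{rd}_J(I)$ is the least such $n$; a minimal reduction is one minimal under inclusion among reductions; $\operatorname{rd}(I)=\min\{\operatorname{rd}_J(I): J\text{ a minimal reduction of }I\}$. An element $x\in I$ is superficial for $I$ if there is $c>0$ with $(I^{n+1}:x)\cap I^c=I^n$ for all $n\ge c$. *)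

(* Defs.v *)
From mathcomp Require Import all_boot all_order all_algebra.
Set Implicit Arguments. Unset Strict Implicit. Unset Printing Implicit Defensive.
Import Order.TTheory GRing.Theory Num.Theory.
Local Open Scope ring_scope.

Section CommAlg.
Variable R : comNzRingType.

Definition iset := R -> Prop.

Definition ideal (I : iset) : Prop :=
  I 0 /\ (forall a b, I a -> I b -> I (a + b)) /\ (forall r a, I a -> I (r * a)).

Definition subI (I J : iset) : Prop := forall y, I y -> J y.
Definition eqI (I J : iset) : Prop := forall y, I y <-> J y.
Definition proper (I : iset) : Prop := ~ I 1.
Definition unitI : iset := fun _ => True.

Definition span (S : iset) : iset :=
  fun y => forall K, ideal K -> subI S K -> K y.

Definition prodI (I J : iset) : iset :=
  span (fun y => exists a b, I a /\ J b /\ y = a * b).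
Fixpoint powI (I : iset) (n : nat) : iset :=
  if n is n'.+1 then prodI (powI I n') I else unitI.

Definition colon (K L : iset) : iset := fun r => forall l, L l -> K (r * l).

Definition prime_ideal (P : iset) : Prop :=
  ideal P /\ proper P /\ (forall a b, P (a * b) -> P a \/ P b).
Definition maximal_ideal (M : iset) : Prop :=
  ideal M /\ proper M /\
  (forall J, ideal J -> proper J -> subI M J -> eqI J M).

Definition noetherian : Prop :=
  forall K : nat -> iset, (forall n, ideal (K n)) ->
    (forall n, subI (K n) (K n.+1)) ->
    exists N, forall n, (N <= n)%N -> subI (K n) (K N).

Definition local_ring (m : iset) : Prop :=
  maximal_ideal m /\ (forall J, maximal_ideal J -> eqI J m).

Definition prime_chain (p : nat -> iset) (n : nat) : Prop :=
  (forall i, (i <= n)%N -> prime_ideal (p i)) /\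
  (forall i, (i < n)%N -> subI (p i) (p i.+1) /\ ~ subI (p i.+1) (p i)).
Definition krull_dim (d : nat) : Prop :=
  (exists p, prime_chain p d) /\ (forall p n, prime_chain p n -> (n <= d)%N).

Definition regular_sequence (xs : seq R) : Prop :=
  proper (span (fun y => y \in xs)) /\
  forall i, (i < size xs)%N -> forall r,
    span (fun y => y \in take i xs) (nth 0 xs i * r) ->
    span (fun y => y \in take i xs) r.

(* local ring (R,m) of dimension d is Cohen-Macaulay: depth m >= d
   (depth <= dim always holds) *)
Definition cohen_macaulay (m : iset) (d : nat) : Prop :=
  exists xs : seq R, size xs = d /\ (forall y, y \in xs -> m y) /\
    regular_sequence xs.

Definition infinite_residue_field (m : iset) : Prop :=
  exists f : nat -> R, forall i j, i <> j -> ~ m (f i - f j).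

(* m-primary: ideal with radical m (in a local ring this is m-primary) *)
Definition m_primary (m I : iset) : Prop :=
  ideal I /\ (forall y, m y <-> exists k, I (y ^+ k)).

Definition ichain (K : nat -> iset) (J : iset) (n : nat) : Prop :=
  eqI (K 0%N) J /\ eqI (K n) unitI /\
  (forall i, (i <= n)%N -> ideal (K i)) /\
  (forall i, (i < n)%N -> subI (K i) (K i.+1) /\ ~ subI (K i.+1) (K i)).
Definition ilength (J : iset) (n : nat) : Prop :=
  (exists K, ichain K J n) /\ (forall K k, ichain K J k -> (k <= n)%N).

Definition hilbert_samuel (I : iset) (H : nat -> nat) : Prop :=
  forall n, ilength (powI I n) (H n).

Definition Hz (H : nat -> nat) (t : int) : nat :=
  if t is Posz n then H n else 0%N.

Definition postulation_number (I : iset) (nI : int) : Prop :=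
  exists (H : nat -> nat) (P : {poly rat}),
    hilbert_samuel I H /\
    (exists N, forall t : nat, (N <= t)%N -> P.[t%:R] = (H t)%:R) /\
    (forall t : int, nI < t -> P.[t%:~R] = (Hz H t)%:R) /\
    (forall n : int, (forall t : int, n < t -> P.[t%:~R] = (Hz H t)%:R) ->
       nI <= n).

Definition ratliff_rush (K : iset) : iset :=
  fun y => exists n, (1 <= n)%N /\ colon (powI K n.+1) (powI K n) y.

Definition rr_stable_from (I : iset) (i : nat) : Prop :=
  forall n, (i <= n)%N -> eqI (ratliff_rush (powI I n)) (powI I n).
Definition rho_index (I : iset) (rho : nat) : Prop :=
  (1 <= rho)%N /\ rr_stable_from I rho /\
  (forall i, (1 <= i)%N -> rr_stable_from I i -> (rho <= i)%N).

Definition reduction (J I : iset) : Prop :=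
  ideal J /\ subI J I /\
  exists n, eqI (prodI J (powI I n)) (powI I n.+1).
Definition minimal_reduction (J I : iset) : Prop :=
  reduction J I /\ (forall K, reduction K I -> subI K J -> eqI K J).
Definition red_num_wrt (J I : iset) (r : nat) : Prop :=
  eqI (prodI J (powI I r)) (powI I r.+1) /\
  (forall n, eqI (prodI J (powI I n)) (powI I n.+1) -> (r <= n)%N).
Definition reduction_number (I : iset) (r : nat) : Prop :=
  (exists J, minimal_reduction J I /\ red_num_wrt J I r) /\
  (forall J s, minimal_reduction J I -> red_num_wrt J I s -> (r <= s)%N).

Definition superficial (x : R) (I : iset) : Prop :=
  I x /\ exists c, (0 < c)%N /\ forall n, (c <= n)%N ->
    eqI (fun y => powI I n.+1 (y * x) /\ powI I c y) (powI I n).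

End CommAlg.

(* Main.v *)
Require Import Defs.
From mathcomp Require Import all_boot all_order all_algebra.
From mathcomp Require Import boolp ring zify.
Import Order.TTheory GRing.Theory Num.Theory.
Local Open Scope ring_scope.

(* Write H(n) for the length of R/I^n and let J be a minimal reduction of I attaining r = rd(I).
   As R is Cohen-Macaulay of dimension 2 with infinite residue field, J = (x, y) for a regular
   sequence x, y, and the Koszul relations of x, y give Huneke's formula
     H(n+1) - 2 H(n) + H(n-1) = l(R/J) - v_n + w_n,
     v_n = l(I^(n+1) / J I^n),   w_n = l((I^n : J) / I^(n-1)).
   Here v_n = 0 for n >= r and w_n = 0 for n > rho, so P has constant second difference l(R/J)
   and f = P - H satisfies f(n+1) - 2 f(n) + f(n-1) = v_n - w_n with f(n) = 0 for large n.
   If r > rho or rho = 1, descending induction gives f = 0 on [r - 1, oo[.  Otherwise it gives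
   f = 0 on [rho, oo[ and f(rho - 1) = - w_rho, which is nonzero by minimality of rho, because I
   multiplies the Ratliff-Rush closure of I^(rho-1) into I^rho; then n(I) = rho - 1. *)

Set Implicit Arguments. Unset Strict Implicit. Unset Printing Implicit Defensive.

(** * Ideals *)

Section Ideals.
Variable R : comNzRingType.
Implicit Types (A B C D I J K L X Y Z : iset R) (a b r x y z : R).

Lemma eqI_eq A B : eqI A B -> A = B.
Proof. by move=> h; apply/funext => y; apply/propext; exact: h. Qed.

Lemma subI_antisym A B : subI A B -> subI B A -> A = B.
Proof. by move=> hAB hBA; apply: eqI_eq => y; split; [exact: hAB|exact: hBA]. Qed.

Lemma ideal0 A : ideal A -> A 0. Proof. by case. Qed.
Lemma idealD A a b : ideal A -> A a -> A b -> A (a + b).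
Proof. by case=> _ [h _]; exact: h. Qed.
Lemma ideal_mull A r a : ideal A -> A a -> A (r * a).
Proof. by case=> _ [_ h]; exact: h. Qed.
Lemma ideal_mulr A r a : ideal A -> A a -> A (a * r).
Proof. by rewrite mulrC; exact: ideal_mull. Qed.
Lemma idealN A a : ideal A -> A a -> A (- a).
Proof. by rewrite -mulN1r; exact: ideal_mull. Qed.
Lemma idealB A a b : ideal A -> A a -> A b -> A (a - b).
Proof. by move=> hA Aa Ab; apply: idealD => //; exact: idealN. Qed.
Lemma ideal_sum A (T : eqType) (s : seq T) (F : T -> R) :
  ideal A -> (forall i, i \in s -> A (F i)) -> A (\sum_(i <- s) F i).
Proof.
move=> hA; elim: s => [|i s IH] h; first by rewrite big_nil; exact: ideal0.
rewrite big_cons; apply: idealD => //; first by apply: h; rewrite mem_head.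
by apply: IH => j js; apply: h; rewrite inE js orbT.
Qed.

Definition addI A B : iset R := fun y => exists a b, [/\ A a, B b & y = a + b].
Definition capI A B : iset R := fun y => A y /\ B y.
Definition scaleI x A : iset R := fun y => exists2 a, A a & y = a * x.
Definition colonE A x : iset R := fun r => A (r * x).
Definition princ x : iset R := scaleI x (@unitI R).
Definition zeroI : iset R := fun y => y = 0.

Lemma ideal_unit : ideal (@unitI R). Proof. by []. Qed.
Lemma ideal_zero : ideal zeroI.
Proof.
split=> //; split=> [a b -> ->|r a ->]; first exact: addr0.
exact: mulr0.
Qed.
Lemma ideal_add A B : ideal A -> ideal B -> ideal (addI A B).
Proof.
move=> hA hB; split; [|split].
- by exists 0, 0; rewrite addr0; split=> //; exact: ideal0.
- move=> _ _ [a [b [Aa Bb ->]]] [c [d [Ac Bd ->]]].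
  by exists (a + c), (b + d); split; [exact: idealD|exact: idealD|ring].
- move=> r _ [a [b [Aa Bb ->]]]; exists (r * a), (r * b).
  by split; [exact: ideal_mull|exact: ideal_mull|ring].
Qed.
Lemma ideal_cap A B : ideal A -> ideal B -> ideal (capI A B).
Proof.
move=> hA hB; split; [|split].
- by split; exact: ideal0.
- by move=> a b [? ?] [? ?]; split; exact: idealD.
- by move=> r a [? ?]; split; exact: ideal_mull.
Qed.
Lemma ideal_scale x A : ideal A -> ideal (scaleI x A).
Proof.
move=> hA; split; [|split].
- by exists 0; [exact: ideal0|ring].
- by move=> _ _ [a Aa ->] [b Ab ->]; exists (a + b); [exact: idealD|ring].
- by move=> r _ [a Aa ->]; exists (r * a); [exact: ideal_mull|ring].
Qed.
Lemma ideal_princ x : ideal (princ x). Proof. exact: ideal_scale. Qed.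
Lemma ideal_colonE A x : ideal A -> ideal (colonE A x).
Proof.
move=> hA; rewrite /colonE; split; [|split].
- by rewrite mul0r; exact: ideal0.
- by move=> a b ha hb; rewrite mulrDl; exact: idealD.
- by move=> r a ha; rewrite -mulrA; exact: ideal_mull.
Qed.
Lemma ideal_colon A B : ideal A -> ideal (colon A B).
Proof.
move=> hA; split; [|split].
- by move=> l _; rewrite mul0r; exact: ideal0.
- by move=> a b ha hb l Bl; rewrite mulrDl; apply: idealD; [|exact: ha|exact: hb].
- by move=> r a ha l Bl; rewrite -mulrA; apply: ideal_mull => //; exact: ha.
Qed.
Lemma ideal_span (S : iset R) : ideal (Defs.span S).
Proof.
split; [|split].
- by move=> K hK _; exact: ideal0.
- by move=> a b ha hb K hK SK; apply: idealD => //; [exact: ha|exact: hb].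
- by move=> r a ha K hK SK; apply: ideal_mull => //; exact: ha.
Qed.
Hint Resolve ideal_unit ideal_zero ideal_princ ideal_span : core.
Hint Resolve ideal_add ideal_cap ideal_scale ideal_colonE ideal_colon : core.

Lemma addI_subl A B : ideal B -> subI A (addI A B).
Proof. by move=> hB y Ay; exists y, 0; rewrite addr0; split=> //; exact: ideal0. Qed.
Lemma addI_subr A B : ideal A -> subI B (addI A B).
Proof. by move=> hA y By; exists 0, y; rewrite add0r; split=> //; exact: ideal0. Qed.
Lemma addI_min A B C : ideal C -> subI A C -> subI B C -> subI (addI A B) C.
Proof.
move=> hC hA hB _ [a [b [Aa Bb ->]]].
by apply: idealD => //; [exact: hA|exact: hB].
Qed.
Lemma addI_mono A B C D : subI A C -> subI B D -> subI (addI A B) (addI C D).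
Proof.
move=> h k _ [a [b [Aa Bb ->]]]; exists a, b.
by split=> //; [exact: h|exact: k].
Qed.
Lemma princ_id x : princ x x. Proof. by exists 1; rewrite ?mul1r. Qed.
Lemma princ_sub x A : ideal A -> A x -> subI (princ x) A.
Proof. by move=> hA Ax _ [r _ ->]; exact: ideal_mull. Qed.
Lemma span_sub (S : iset R) K : ideal K -> subI S K -> subI (Defs.span S) K.
Proof. by move=> hK SK y; apply. Qed.
Lemma span_in (S : iset R) : subI S (Defs.span S).
Proof. by move=> y Sy K _; apply. Qed.

Definition gen (s : seq R) : iset R := Defs.span (fun y => y \in s).
Lemma ideal_gen s : ideal (gen s). Proof. exact: ideal_span. Qed.
Hint Resolve ideal_gen : core.
Lemma gen_nil : gen [::] = zeroI.
Proof.
apply: subI_antisym; first by apply: span_sub.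
by move=> _ ->; exact: ideal0.
Qed.
Lemma gen_cons x s : gen (x :: s) = addI (princ x) (gen s).
Proof.
apply: subI_antisym.
- apply: span_sub; first by auto.
  move=> y; rewrite inE => /orP[/eqP ->|ys].
    by apply: addI_subl; [|exact: princ_id].
  by apply: addI_subr; [|exact: span_in].
- apply: addI_min => //.
    by apply: princ_sub => //; apply: span_in; rewrite mem_head.
  by apply: span_sub => // y ys; apply: span_in; rewrite inE ys orbT.
Qed.
Lemma gen_sub s A : ideal A -> (forall y, y \in s -> A y) -> subI (gen s) A.
Proof. by move=> hA h; apply: span_sub. Qed.
Lemma gen_mem s y : y \in s -> gen s y.
Proof. exact: span_in. Qed.

(** * Products and powers of ideals *)

Lemma ideal_prod A B : ideal (prodI A B). Proof. exact: ideal_span. Qed.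
Hint Resolve ideal_prod : core.
Lemma prodI_mul A B a b : A a -> B b -> prodI A B (a * b).
Proof. by move=> Aa Bb; apply: span_in; exists a, b. Qed.
Lemma prodI_sub A B K : ideal K -> (forall a b, A a -> B b -> K (a * b)) ->
  subI (prodI A B) K.
Proof. by move=> hK h; apply: span_sub => // _ [a [b [Aa [Bb ->]]]]; exact: h. Qed.
Lemma prodI_mono A B C D : subI A C -> subI B D -> subI (prodI A B) (prodI C D).
Proof.
move=> h k; apply: prodI_sub => // a b Aa Bb.
by apply: prodI_mul; [exact: h|exact: k].
Qed.
Lemma prodI_comm A B : prodI A B = prodI B A.
Proof.
by apply: subI_antisym; apply: prodI_sub => // a b ha hb; rewrite mulrC;
  exact: prodI_mul.
Qed.
Lemma prodI_subr A B : ideal B -> subI (prodI A B) B.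
Proof. by move=> hB; apply: prodI_sub => // a b _; exact: ideal_mull. Qed.
Lemma prodI_subl A B : ideal A -> subI (prodI A B) A.
Proof. by move=> hA; rewrite prodI_comm; exact: prodI_subr. Qed.
Lemma prod_unitI A : ideal A -> prodI (@unitI R) A = A.
Proof.
move=> hA; apply: subI_antisym; first exact: prodI_subr.
by move=> y Ay; rewrite -[y]mul1r; exact: prodI_mul.
Qed.
Lemma prodI_assoc A B C : prodI (prodI A B) C = prodI A (prodI B C).
Proof.
have key X Y Z : subI (prodI (prodI X Y) Z) (prodI X (prodI Y Z)).
  apply: prodI_sub => // a c ha Zc.
  suff h : subI (prodI X Y) (colonE (prodI X (prodI Y Z)) c) by exact: h.
  apply: prodI_sub; first exact: ideal_colonE.
  by move=> u v Xu Yv; rewrite /colonE -mulrA; do 2![apply: prodI_mul => //].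
apply: subI_antisym; first exact: key.
rewrite (prodI_comm A (prodI B C)) (prodI_comm (prodI A B) C).
by rewrite (prodI_comm A B) (prodI_comm B C).
Qed.

Lemma ideal_pow I n : ideal (powI I n).
Proof. by case: n => [|n]; [exact: ideal_unit|exact: ideal_prod]. Qed.
Hint Resolve ideal_pow : core.
Lemma powI1 I : ideal I -> powI I 1 = I.
Proof. exact: prod_unitI. Qed.
Lemma powS I n : powI I n.+1 = prodI (powI I n) I. Proof. by []. Qed.
Lemma powD I p q : ideal I -> powI I (p + q) = prodI (powI I p) (powI I q).
Proof.
move=> hI; elim: q => [|q IH].
  by rewrite addn0 /= prodI_comm prod_unitI.
by rewrite addnS /= IH prodI_assoc.
Qed.
Lemma powM I p q : ideal I -> powI (powI I p) q = powI I (p * q).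
Proof.
move=> hI; elim: q => [|q IH]; first by rewrite muln0.
by rewrite mulnS addnC powD //= IH.
Qed.
Lemma pow_mono I J n : subI I J -> subI (powI I n) (powI J n).
Proof. by move=> h; elim: n => [|n IH] //=; exact: prodI_mono. Qed.
Lemma pow_anti I p q : ideal I -> (p <= q)%N -> subI (powI I q) (powI I p).
Proof. by move=> hI /subnKC <-; rewrite powD //; exact: prodI_subl. Qed.
Lemma pow_exp I a n : I a -> powI I n (a ^+ n).
Proof. by move=> Ia; elim: n => [|n IH] //; rewrite exprSr; exact: prodI_mul. Qed.
Lemma powD_mul I a b p q : ideal I ->
  powI I p a -> powI I q b -> powI I (p + q) (a * b).
Proof. by move=> hI ha hb; rewrite powD //; exact: prodI_mul. Qed.
(** Pigeonhole: a product of [i + j] elements of [A + B] expands into terms with at least [i]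
    factors in [A] or at least [j] factors in [B]. The induction splits off the last factor. *)
Lemma pow_addI A B i j : ideal A -> ideal B ->
  subI (powI (addI A B) (i + j)) (addI (powI A i) (powI B j)).
Proof.
move=> hA hB; have [n] := ubnP (i + j); elim: n i j => // n IH [|i] [|j] lt_n.
- by move=> y _; apply: addI_subl.
- by move=> y _; apply: addI_subl.
- by move=> y _; apply: addI_subr.
rewrite addSn /=; apply: prodI_sub; first by auto.
move=> u _ hu [a [b [Aa Bb ->]]]; rewrite mulrDr.
apply: idealD; first by auto.
  have /IH - /(_ u hu) [c [d [hc hd ->]]] : (i + j.+1 < n)%N by lia.
  exists (c * a), (d * a); split; last by ring.
    exact: prodI_mul.
  exact: (ideal_mulr a (ideal_prod _ _)).
move: hu; rewrite addnS -addSn => hu.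
have /IH - /(_ u hu) [c [d [hc hd ->]]] : (i.+1 + j < n)%N by lia.
exists (c * b), (d * b); split; last by ring.
  exact: (ideal_mulr b (ideal_prod _ _)).
exact: prodI_mul.
Qed.

End Ideals.

(** * Length *)

#[local] Hint Resolve ideal_unit ideal_zero ideal_princ ideal_span : core.
#[local] Hint Resolve ideal_add ideal_cap ideal_scale ideal_colonE ideal_colon : core.
#[local] Hint Resolve ideal_gen ideal_prod ideal_pow : core.

Section Length.
Variable R : comNzRingType.
Implicit Types (A B C D I J K L X Y Z : iset R) (a b r x y z : R).

(* [A / B] has length at most [n], for an ideal [A] containing the ideal [B]. *)
Fixpoint lenle n B A : Prop :=
  if n is n'.+1 then
    forall K, ideal K -> subI B K -> ~ subI K B -> subI K A -> lenle n' K A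
  else subI A B.

Lemma lenleW n k B A : (n <= k)%N -> lenle n B A -> lenle k B A.
Proof.
elim: n k B => [|n IH] [|k] B //=; last first.
  by move=> nk h K hK BK KB KA; apply: IH => //; exact: h.
by move=> _ AB K hK BK nKB KA; case: nKB => y /KA /AB.
Qed.

Lemma lenle_top n B A D : subI D A -> lenle n B A -> lenle n B D.
Proof.
elim: n B => [|n IH] B DA /=; first by move=> h y /DA /h.
move=> h K hK BK KB KD; apply: IH => //; apply: h => //.
by move=> y /KD /DA.
Qed.

Lemma lenle_bot n B A D : subI B D -> lenle n B A -> lenle n D A.
Proof.
case: n => [|n] BD /=; first by move=> h y /h /BD.
move=> h K hK DK KD KA; apply: h => //; first by move=> y /BD /DK.
by move=> KB; apply: KD => y /KB /BD.
Qed.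


(** By the modular law, a strict enlargement of [K] inside [A] strictly enlarges the intersection
    with [B] or the sum with [B], so each step uses up one unit of [p] or of [q]. *)
Lemma lenle_glue p q B A K : ideal A -> ideal B -> ideal K -> subI B A -> subI K A ->
  lenle p (capI K B) B -> lenle q (addI K B) A -> lenle (p + q) K A.
Proof.
move=> hA hB hK BA; have [n] := ubnP (p + q).
elim: n p q K hK => // n IH p q K hK lt_n KA hp hq.
have step L : ideal L -> subI K L -> ~ subI L K ->
    ~ subI (capI L B) (capI K B) \/ ~ subI (addI L B) (addI K B).
  move=> hL KL LK; apply/not_andP => -[h1 h2]; apply: LK => y Ly.
  have [k [b [Kk Bb yE]]] := h2 _ (addI_subl hB Ly).
  have [] := h1 b; first split=> //.
    by rewrite (_ : b = y - k); [exact: idealB (KL _ Kk)|rewrite yE; ring].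
  by move=> Kb _; rewrite yE; exact: idealD.
case pqE: (p + q)%N => [|s] /=.
  have [p0 q0] : p = 0%N /\ q = 0%N by lia.
  move: hp hq; rewrite p0 q0 /= => hp hq; apply: contrapT => AK.
  have AKB : subI A (addI K B) by [].
  move=> {step}; apply: AK => y /AKB [k [b [Kk Bb ->]]].
  by apply: idealD => //; case: (hp b Bb).
move=> L hL KL LK LA; have [nLK|nLK] := step L hL KL LK.
  case: p pqE hp lt_n => [|p] pqE hp lt_n.
    by case: nLK => y [_ By]; exact: hp.
  have -> : s = (p + q)%N by lia.
  apply: IH => //.
    apply: hp => //; first by auto.
    - by move=> y [Ky By]; split=> //; exact: KL.
    - by move=> y [].
  by apply: lenle_bot hq; apply: addI_mono.
case: q pqE hq lt_n => [|q] pqE hq lt_n.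
  case: nLK; apply: addI_min; first by auto.
    by move=> y /LA /hq.
  exact: addI_subr.
have -> : s = (p + q)%N by lia.
apply: IH => //; first by lia.
  apply: lenle_bot hp => y [Ky By]; split=> //; exact: KL.
apply: hq => //; first by auto.
- by apply: addI_mono.
- exact: addI_min.
Qed.

(** Superadditivity: a strict chain of more than [p] steps from [C] to [B], continued by one of more
    than [q] steps from [B] to [A], has at least [p + q + 2] steps. *)
Lemma lenle_split p q C B A : ideal B -> subI C B -> subI B A ->
  ~ lenle p C B -> ~ lenle q B A -> ~ lenle (p + q).+1 C A.
Proof.
move=> hB CB BA; elim: p C CB => [|p IH] C CB nCB nBA h.
  by apply: nBA; apply: h.
apply: nCB => K hK CK KC KB; apply: contrapT => nKB.
by apply: (IH K KB nKB nBA); apply: (h K) => // y /KB /BA.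
Qed.

Definition flen B A := exists n, lenle n B A.

(* Junk value [0] when the length of [A / B] is infinite. *)
Definition len B A : nat :=
  if pselect (exists n, `[< lenle n B A >]) is left h then ex_minn h else 0%N.

Lemma lenle_len B A : flen B A -> lenle (len B A) B A.
Proof.
case=> n hn; rewrite /len; case: pselect => [h|[]]; last by exists n; apply/asboolP.
by case: ex_minnP => k /asboolP.
Qed.

Lemma len_le n B A : lenle n B A -> (len B A <= n)%N.
Proof.
rewrite /len => hn; case: pselect => // h.
by case: ex_minnP => k _; apply; apply/asboolP.
Qed.

Lemma flen_top B A D : subI D A -> flen B A -> flen B D.
Proof. by move=> DA [n h]; exists n; exact: lenle_top h. Qed.
Lemma flen_bot B A D : subI B D -> flen B A -> flen D A.
Proof. by move=> BD [n h]; exists n; exact: lenle_bot h. Qed.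
Lemma len_top B A D : subI D A -> flen B A -> (len B D <= len B A)%N.
Proof. by move=> DA h; apply: len_le; exact: lenle_top (lenle_len h). Qed.
Lemma len_bot B A D : subI B D -> flen B A -> (len D A <= len B A)%N.
Proof. by move=> DA h; apply: len_le; exact: lenle_bot (lenle_len h). Qed.

Lemma len_eq0 B A : flen B A -> (len B A = 0)%N <-> subI A B.
Proof.
move=> h; split=> [h0|AB]; first by have := lenle_len h; rewrite h0.
by apply/eqP; rewrite -leqn0; exact: (@len_le 0).
Qed.

Section Additivity.
Variables (A B C : iset R).
Hypotheses (hA : ideal A) (hB : ideal B) (hC : ideal C).
Hypotheses (CB : subI C B) (BA : subI B A).

Lemma lenle_add p q : lenle p C B -> lenle q B A -> lenle (p + q) C A.
Proof.
move=> hp hq; apply: (@lenle_glue p q B A C) => //; first by move=> y /CB /BA.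
  by apply: lenle_bot hp => y Cy; split=> //; exact: CB.
by apply: lenle_bot hq; exact: addI_subr.
Qed.

Lemma flen_add : flen C B -> flen B A -> flen C A.
Proof. by move=> [p hp] [q hq]; exists (p + q)%N; exact: lenle_add. Qed.

Lemma len_add : flen C A -> len C A = (len C B + len B A)%N.
Proof.
move=> h; have fCB := flen_top BA h; have fBA := flen_bot CB h.
apply/eqP; rewrite eqn_leq; apply/andP; split.
  by apply: len_le; apply: lenle_add; exact: lenle_len.
case p: (len C B) => [|p'].
  have /len_eq0 - /(_ fCB) BC : len C B = 0%N by [].
  by rewrite add0n; exact: len_bot.
case q: (len B A) => [|q'].
  have /len_eq0 - /(_ fBA) AB : len B A = 0%N by [].
  by rewrite addn0 -p; exact: len_top.
rewrite addSn addnS leqNgt; apply/negP => lt.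
have n1 : ~ lenle p' C B by move/len_le; rewrite p ltnn.
have n2 : ~ lenle q' B A by move/len_le; rewrite q ltnn.
apply: (lenle_split hB CB BA n1 n2).
by apply: lenleW (lenle_len h).
Qed.
End Additivity.

Section Isomorphism.
Variables (A C : iset R) (x : R).
Hypotheses (hA : ideal A) (hC : ideal C).

(** The induction runs over all [L] between [C] and [x A + C]. An ideal [K] strictly above
    [A :&: (L : x)] is sent to [x K + L], from which it is recovered as [A :&: ((x K + L) : x)]. *)
Lemma lenle_iso_to n L : ideal L -> subI C L -> subI L (addI (scaleI x A) C) ->
  lenle n L (addI (scaleI x A) C) -> lenle n (capI A (colonE L x)) A.
Proof.
elim: n L => [|n IH] L hL CL LD /=.
  move=> h y Ay; split=> //; apply: h; apply: addI_subl => //.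
  by exists y.
move=> h K hK AK KA KA'.
have -> : K = capI A (colonE (addI (scaleI x K) L) x).
  apply: subI_antisym => y.
    move=> Ky; split; first exact: KA'.
    by apply: addI_subl => //; exists y.
  case=> Ay [_ [l [[k Kk ->] Ll E]]].
  have -> : y = (y - k) + k by ring.
  apply: idealD => //; apply: AK; split; first by apply: idealB => //; exact: KA'.
  by rewrite /colonE mulrBl E (_ : _ - _ = l) //; ring.
have sub : subI (addI (scaleI x K) L) (addI (scaleI x A) C).
  apply: addI_min => //; first by auto.
  by move=> _ [k Kk ->]; apply: addI_subl => //; exists k => //; exact: KA'.
apply: IH => //; [by auto| |apply: h => //; [by auto| |]].
- by move=> y /CL Ly; apply: addI_subr => //; auto.
- by apply: addI_subr; auto.
- move=> sL; apply: KA => y Ky; split; first exact: KA'.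
  by apply: sL; apply: addI_subl => //; exists y.
Qed.

Lemma lenle_iso_from n L : ideal L -> subI C L -> subI L (addI (scaleI x A) C) ->
  lenle n (capI A (colonE L x)) A -> lenle n L (addI (scaleI x A) C).
Proof.
elim: n L => [|n IH] L hL CL LD /=.
  by move=> h; apply: addI_min => // _ [a /h [_ La] ->].
move=> h K hK LK KL KD; apply: IH => //; first by move=> y /CL /LK.
apply: h; [by auto| | |by move=> y []].
  by move=> y [Ay ?]; split=> //; exact: LK.
move=> h; apply: KL => y Ky; have [_ [c [[a Aa ->] Cc E]]] := KD y Ky.
have Kax : K (a * x).
  by rewrite (_ : _ * _ = y - c); [apply: idealB => //; apply: LK; exact: CL|rewrite E; ring].
have [_ Lax] := h a (conj Aa Kax).
by rewrite E; apply: idealD => //; exact: CL.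
Qed.

(* [(x A + C) / C] is isomorphic to [A / (A :&: (C : x))] by multiplication by [x]. *)
Lemma lenle_iso n :
  lenle n C (addI (scaleI x A) C) <-> lenle n (capI A (colonE C x)) A.
Proof.
by split; [apply: lenle_iso_to|apply: lenle_iso_from] => //; apply: addI_subr; auto.
Qed.

Lemma flen_iso : flen C (addI (scaleI x A) C) <-> flen (capI A (colonE C x)) A.
Proof. by split=> -[n /lenle_iso h]; exists n. Qed.

Lemma len_iso : flen C (addI (scaleI x A) C) ->
  len C (addI (scaleI x A) C) = len (capI A (colonE C x)) A.
Proof.
move=> h; have h' := flen_iso.1 h; apply/eqP; rewrite eqn_leq.
by apply/andP; split; apply: len_le; apply/lenle_iso; exact: lenle_len.
Qed.
End Isomorphism.

(** * Agreement with the length defined by chains of ideals *)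

Lemma chain_extend J K k (X : nat -> iset R) : ideal J -> ichain X K k -> subI J K -> ~ subI K J ->
  ichain (fun i => if i is i'.+1 then X i' else J) J k.+1.
Proof.
move=> hJ [h0 [hk [hX hs]]] JK KJ; split=> //; split=> //; split.
  by case=> [|i] // /hX.
case=> [_|i /hs] //; split; first by move=> y /JK /h0.
by move=> h; apply: KJ => y /h0 /h.
Qed.

Lemma chain_le J (X : nat -> iset R) k n : ichain X J k -> lenle n J (@unitI R) -> (k <= n)%N.
Proof.
elim: k n J X => [|k IH] n J X // [h0 [hk [hX hs]]] h.
have [s1 s2] := hs 0%N isT.
have XS : ichain (fun i => X i.+1) (X 1%N) k.
  split=> //; split=> //; split; first by move=> i; exact: (hX i.+1).
  by move=> i; exact: (hs i.+1).
case: n h => [|n] h; first by case: s2 => y _; apply/h0; exact: h.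
apply: (IH n _ _ XS); apply: h => //; first by exact: hX.
  by move=> y /h0 /s1.
by move=> h; apply: s2 => y /h /h0.
Qed.

Lemma lenle_chain J n : ideal J -> (forall W k, ichain W J k -> (k <= n)%N) ->
  lenle n J (@unitI R).
Proof.
elim: n J => [|n IH] J hJ h.
  apply: contrapT => nJ.
  have X : ichain (fun _ => @unitI R) (@unitI R) 0.
    by split=> //; split=> //; split=> //.
  by have := h _ _ (chain_extend hJ X (fun _ _ => I) nJ).
move=> K hK JK KJ _; apply: IH => // X k /(chain_extend hJ) => /(_ JK KJ).
by move=> /h.
Qed.

Lemma ilength_len J n : ideal J -> ilength J n ->
  flen J (@unitI R) /\ len J (@unitI R) = n.
Proof.
move=> hJ [[X hX] hmax]; have h := lenle_chain hJ hmax.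
split; first by exists n.
apply/eqP; rewrite eqn_leq len_le //=.
by apply: (chain_le hX); apply: lenle_len; exists n.
Qed.

End Length.

(** * Huneke's formula *)

Section Huneke.
Variable R : comNzRingType.
Implicit Types (A B C D I J K L X Y Z : iset R) (a b r x y z : R).

Definition regular_pair x y : Prop :=
  (forall r, r * x = 0 -> r = 0) /\ (forall r, princ x (r * y) -> princ x r).

Definition pairI x y : iset R := addI (princ x) (princ y).

Lemma ideal_pair x y : ideal (pairI x y). Proof. by apply: ideal_add. Qed.
Hint Resolve ideal_pair : core.

Lemma pair_l x y : pairI x y x.
Proof. by apply: addI_subl => //; exact: princ_id. Qed.
Lemma pair_r x y : pairI x y y.
Proof. by apply: addI_subr => //; exact: princ_id. Qed.
Lemma pair_sub x y A : ideal A -> A x -> A y -> subI (pairI x y) A.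
Proof. by move=> hA Ax Ay; apply: addI_min => //; exact: princ_sub. Qed.

Lemma prod_pair x y K : ideal K ->
  prodI (pairI x y) K = addI (scaleI x K) (scaleI y K).
Proof.
move=> hK; apply: subI_antisym.
  apply: prodI_sub; first by auto.
  move=> _ k [_ [_ [[a _ ->] [b _ ->] ->]]] Kk.
  exists (a * k * x), (b * k * y); split; last by ring.
    by exists (a * k) => //; exact: ideal_mull.
  by exists (b * k) => //; exact: ideal_mull.
apply: addI_min => // _ [k Kk ->]; rewrite mulrC; apply: prodI_mul => //.
  exact: pair_l.
exact: pair_r.
Qed.

Lemma cap_unitl Z : capI (@unitI R) Z = Z.
Proof. by apply: subI_antisym => y; [case|split]. Qed.

Lemma colon_pair K x y : ideal K ->
  colon K (pairI x y) = capI (colonE K x) (colonE K y).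
Proof.
move=> hK; apply: subI_antisym => r.
  by move=> h; split; apply: h; [exact: pair_l|exact: pair_r].
case=> hx hy l hl; suff h : subI (pairI x y) (colonE K r).
  by rewrite mulrC; exact: h.
by apply: pair_sub; [auto|rewrite /colonE mulrC|rewrite /colonE mulrC].
Qed.

(* The filtration [(x, y) K <= (x) + y K <= (x, y)] has successive quotients [R / ((x) + K)]
   (on top) and [R / (K + y (K : x))]. *)
Lemma len_pair_prod K x y : ideal K -> flen K (@unitI R) -> regular_pair x y ->
  flen (prodI (pairI x y) K) (pairI x y) /\
  (len (prodI (pairI x y) K) (pairI x y) + len (colon K (pairI x y)) (@unitI R) =
   2 * len K (@unitI R))%N.
Proof.
move=> hK fK [regx regy].
set J := pairI x y; set JK := prodI J K.
have JKE : JK = addI (scaleI x K) (scaleI y K) by exact: prod_pair.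
pose D := addI (princ x) (scaleI y K).
have hD : ideal D by apply: ideal_add; auto.
have JKD : subI JK D.
  rewrite JKE; apply: addI_mono => //.
  by move=> _ [k Kk ->]; exists k.
have DJ : subI D J by apply: addI_mono => // _ [k Kk ->]; exists k.
have xK : ideal (addI (princ x) K) by auto.
have KxK : subI K (addI (princ x) K) by exact: addI_subr.
have hJK : ideal JK by apply: ideal_prod.
have hJ : ideal J by apply: ideal_pair.
have DE : D = addI (scaleI x (@unitI R)) JK.
  apply: subI_antisym.
    apply: addI_min; [by auto|by apply: addI_subl|].
    move=> z hz; apply: addI_subr; first by auto.
    by rewrite JKE; apply: addI_subr; auto.
  by apply: addI_min => //; apply: addI_subl; auto.
have JE : J = addI (scaleI y (@unitI R)) D.
  apply: subI_antisym.
    apply: addI_min; [by auto| |by apply: addI_subl].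
    by move=> z hz; apply: addI_subr; [auto|apply: addI_subl; auto].
  by apply: addI_min => //; apply: addI_subr.
have colDy : capI (@unitI R) (colonE D y) = addI (princ x) K.
  rewrite cap_unitl; apply: subI_antisym => r.
    case=> _ [_ [[s _ ->] [k Kk ->] E]].
    have /regy h : princ x ((r - k) * y).
      by exists s => //; rewrite mulrBl E; ring.
    by exists (r - k), k; split=> //; ring.
  case=> _ [k [[s _ ->] Kk ->]].
  exists (s * y * x), (k * y); split; [by exists (s * y)|by exists k|by ring].
pose E := addI (scaleI y (colonE K x)) K.
have hE : ideal E by apply: ideal_add; auto.
have KE : subI K E by apply: addI_subr; auto.
(* The Koszul relation enters here: [r x = i x + j y] forces [j = k x] by regularity of [y] modulo
   [x], hence [r = i + k y] with [k] in [(K : x)]. *)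
have colJKx : capI (@unitI R) (colonE JK x) = E.
  rewrite cap_unitl JKE; apply: subI_antisym => r.
    case=> _ [_ [[i Ki ->] [j Kj ->] Er]].
    have /regy [k _ jE] : princ x (j * y) by exists (r - i) => //; rewrite mulrBl Er; ring.
    have /regx h : (r - i - k * y) * x = 0 by rewrite !mulrBl Er jE; ring.
    exists (k * y), i; split=> //; last by move/eqP: h; rewrite subr_eq0 subr_eq => /eqP ->.
    by exists k => //; rewrite /colonE -jE.
  case=> _ [i [[k kx ->] Ki ->]].
  exists (i * x), (k * x * y); split; [by exists i|by exists (k * x)|by ring].
have Kx : subI K (colonE K x) by move=> k Kk; exact: ideal_mulr.
have fxK : flen (addI (princ x) K) (@unitI R) by apply: flen_bot fK.
have fE : flen E (@unitI R) by apply: flen_bot fK.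
have fDJ : flen D J by rewrite JE; apply/flen_iso => //; rewrite colDy.
have fJKD : flen JK D by rewrite DE; apply/flen_iso; auto; rewrite colJKx.
have fJK : flen JK J by apply: (flen_add _ hD _ JKD DJ); auto; exact: ideal_pair.
split=> //.
rewrite (len_add _ hD _ JKD DJ) //; try exact: ideal_pair.
have -> : len D J = len (addI (princ x) K) (@unitI R).
  by move: fDJ; rewrite JE => /len_iso ->; rewrite ?colDy.
have -> : len JK D = len E (@unitI R).
  by move: fJKD; rewrite DE => /len_iso ->; rewrite ?colJKx //; auto.
(* Multiplication by [x] and by [y] gives [l(((x) + K) / K) = l(R / (K : x))] and
   [l(E / K) = l((K : x) / (K : J))]; these two add up to [l(R / (K : J))]. *)
have e1 := len_add (ideal_unit R) xK hK KxK (fun _ _ => I) fK.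
have e2 := len_add (ideal_unit R) hE hK KE (fun _ _ => I) fK.
have xx : addI (princ x) K = addI (scaleI x (@unitI R)) K by [].
have e3 : len K (addI (princ x) K) = len (colonE K x) (@unitI R).
  by rewrite xx len_iso -?xx // ?cap_unitl //; exact: flen_top fK.
have e4 : len K E = len (colon K J) (colonE K x).
  rewrite len_iso //; auto; last exact: flen_top fK.
  by rewrite colon_pair.
have fKJ : flen (colon K J) (@unitI R).
  by apply: flen_bot fK => k Kk l _; exact: ideal_mulr.
have sub : subI (colon K J) (colonE K x) by rewrite colon_pair // => z [].
have e5 := len_add (ideal_unit R) (ideal_colonE x hK) (ideal_colon J hK) sub
  (fun _ _ => I) fKJ.
by lia.
Qed.

End Huneke.

(** * Noetherian local rings *)

#[local] Hint Resolve ideal_pair : core.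

Section Noetherian.
Variable R : comNzRingType.
Implicit Types (A B C D I J K L M P Q X Y Z m : iset R) (a b r u x y z : R).

Lemma noetherian_max (F : iset R -> Prop) A : noetherian R ->
  (forall B, F B -> ideal B) -> F A ->
  exists2 M, F M & forall B, F B -> subI M B -> subI B M.
Proof.
move=> noeth idF FA; apply: contrapT => nmax.
have /choice [f hf] : forall s : {B | F B}, exists t : {B | F B},
    subI (sval s) (sval t) /\ ~ subI (sval t) (sval s).
  case=> B FB; apply: contrapT => nB; apply: nmax; exists B => // C FC BC.
  by apply: contrapT => nCB; apply: nB; exists (exist _ C FC).
pose K n := sval (iter n f (exist _ A FA)).
have [||N hN] := noeth K.
- by move=> n; apply: idF; exact: svalP.
- by move=> n; case: (hf (iter n f (exist _ A FA))).
by case: (hf (iter N f (exist _ A FA))) => _; apply; exact: (hN N.+1).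
Qed.

Lemma noetherian_fg A : noetherian R -> ideal A -> exists s, A = gen s.
Proof.
move=> noeth hA.
pose F B := exists2 s, (forall y, y \in s -> A y) & B = gen s.
have [||M [s sA ->] maxM] := @noetherian_max F (gen [::]) noeth.
- by move=> _ [s _ ->].
- by exists [::].
exists s; apply: subI_antisym; last exact: gen_sub.
move=> y Ay; apply: (maxM (gen (y :: s))).
- exists (y :: s) => // z; rewrite inE => /orP[/eqP ->|] //; exact: sA.
- by rewrite gen_cons; apply: addI_subr.
- by apply: gen_mem; rewrite mem_head.
Qed.

(** An ideal maximal among those that contain [K] and miss [S] is prime: if [a] and [b] lie outside
    it, adjoining either one produces an element of [S], and the product of these two elements would
    lie in the ideal together with [a * b]. *)
Lemma prime_avoiding K (S : R -> Prop) : noetherian R -> ideal K ->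
  S 1 -> (forall a b, S a -> S b -> S (a * b)) -> (forall y, K y -> ~ S y) ->
  exists P, [/\ prime_ideal P, subI K P & forall y, P y -> ~ S y].
Proof.
move=> noeth hK S1 SM KS.
pose F B := [/\ ideal B, subI K B & forall y, B y -> ~ S y].
have [||M [hM KM MS] maxM] := @noetherian_max F K noeth.
- by move=> B [].
- by split.
exists M; split=> //; split=> //; split; first by move=> /MS.
move=> a b Mab; apply: contrapT => /not_orP [nMa nMb].
have meets c : ~ M c -> exists u r, M u /\ S (u + r * c).
  move=> nMc; apply: contrapT => nS.
  have FMc : F (addI M (princ c)).
    split; [by auto|by move=> y /KM; apply: addI_subl|].
    by move=> _ [u [_ [Mu [r _ ->] ->]]] Su; apply: nS; exists u, r.
  apply: nMc; apply: (maxM _ FMc); first exact: addI_subl.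
  by apply: addI_subr => //; exact: princ_id.
have [u [r [Mu Su]]] := meets a nMa; have [v [t [Mv Sv]]] := meets b nMb.
apply: (MS _ _ (SM _ _ Su Sv)).
have -> : (u + r * a) * (v + t * b) = (v + t * b) * u + r * a * v + r * t * (a * b)
  by ring.
by apply: idealD => //; [apply: idealD => //|]; apply: ideal_mull.
Qed.

Lemma ideal_proper_sub m K : noetherian R -> local_ring m -> ideal K -> Defs.proper K ->
  subI K m.
Proof.
move=> noeth [_ uniq_m] hK pK.
pose F B := [/\ ideal B, subI K B & Defs.proper B].
have [||M [hM KM pM] maxM] := @noetherian_max F K noeth; [by move=> B []|by split|].
have mM : eqI M m.
  apply: uniq_m; split=> //; split=> // J hJ pJ MJ y; split; last exact: MJ.
  by apply: maxM => //; split=> // z /KM /MJ.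
by move=> y /KM /mM.
Qed.

Lemma local_unit m u : noetherian R -> local_ring m -> ~ m u -> exists v, v * u = 1.
Proof.
move=> noeth loc nu; apply: contrapT => nv; apply: nu.
apply: (ideal_proper_sub noeth loc (ideal_princ u)); last exact: princ_id.
by case=> v _ e; apply: nv; exists v.
Qed.

Lemma local_prime m : noetherian R -> local_ring m -> prime_ideal m.
Proof.
move=> noeth loc; have [[hm [pm _]] _] := loc; split=> //; split=> // a b mab.
have [|/(local_unit noeth loc) [v va]] := pselect (m a); [by left|right].
by rewrite -[b]mul1r -va -mulrA; exact: ideal_mull.
Qed.

(** Generators of [A] modulo [B] are discarded one at a time: [g] lies in [B + (s) + m g], so
    [(1 - u) g] lies in [B + (s)] for some [u] in [m], and [1 - u] is a unit. *)
Lemma nakayama m A B : noetherian R -> local_ring m -> ideal A -> ideal B ->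
  subI A (addI B (prodI m A)) -> subI A B.
Proof.
move=> noeth loc hA hB hAB; have [[hm [pm _]] _] := loc.
have [s sA] := noetherian_fg noeth hA.
have {sA} [sA] : (forall y, y \in s -> A y) /\ subI A (addI B (gen s)).
  split; first by rewrite sA => y; exact: gen_mem.
  by rewrite -sA; exact: addI_subr.
elim: s sA => [|g s IH] sA AB.
  by move=> y /AB [b [z [Bb]]]; rewrite gen_nil => -> ->; rewrite addr0.
apply: IH => [y ys|]; first by apply: sA; rewrite inE ys orbT.
have mA : subI (prodI m A) (addI (addI B (gen s)) (scaleI g m)).
  apply: prodI_sub => [|u y mu Ay]; first by auto.
  have [b [w [Bb]]] := AB y Ay; rewrite gen_cons => -[_ [z [[r _ ->] hz ->]]] ->.
  exists (u * b + u * z), (u * r * g); split; last by ring.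
    exists (u * b), (u * z); split=> //; first exact: (ideal_mull u hB).
    exact: (ideal_mull u (ideal_gen s)).
  by exists (u * r) => //; exact: ideal_mulr.
have hg : addI B (gen s) g.
  have /hAB [b [w [Bb /mA [c [_ [hc [u mu ->] ->]]] gE]]] : A g.
    by apply: sA; rewrite mem_head.
  have [|v vu] := @local_unit m (1 - u) noeth loc.
    by move=> h; apply: pm; rewrite -(subrK u 1); exact: idealD.
  have -> : g = v * (b + c).
    rewrite -[LHS]mul1r -vu -mulrA; congr (_ * _).
    by rewrite mulrBl mul1r {1}gE; ring.
  apply: ideal_mull; first by auto.
  by apply: idealD; [auto|exact: addI_subl|].
move=> y /AB [b [z [Bb hz ->]]]; apply: idealD; [by auto|exact: addI_subl|].
move: z hz; suff: subI (gen (g :: s)) (addI B (gen s)) by [].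
rewrite gen_cons; apply: addI_min; [by auto| |exact: addI_subr].
by apply: princ_sub => //; auto.
Qed.

Lemma regular_sequence_pair a b : regular_sequence [:: a; b] -> regular_pair a b.
Proof.
case=> _ h; split=> r.
  move=> ra; have := h 0%N isT r; rewrite -/(gen [::]) gen_nil; apply.
  by rewrite mulrC.
move=> hr; have := h 1%N isT r; rewrite -/(gen [:: a]) gen_cons gen_nil.
have -> : addI (princ a) (@zeroI R) = princ a.
  apply: subI_antisym; last exact: addI_subl.
  by apply: addI_min => // _ ->; exact: ideal0.
by apply; rewrite mulrC.
Qed.


(** For a prime [P], the multiplicative set generated by [a] and the complement of [P]; a prime
    ideal that misses it lies in [P] and does not contain [a]. *)
Definition power_mul a P : R -> Prop := fun y => exists i s, ~ P s /\ y = a ^+ i * s.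

Lemma power_mul1 a P : Defs.proper P -> power_mul a P 1.
Proof. by exists 0%N, 1; rewrite expr0 mulr1. Qed.
Lemma power_mulM a P c d : prime_ideal P ->
  power_mul a P c -> power_mul a P d -> power_mul a P (c * d).
Proof.
move=> [_ [_ pP]] [i [s [Ps ->]]] [j [t [Pt ->]]]; exists (i + j)%N, (s * t).
by split; [case/pP|rewrite exprD; ring].
Qed.

(** As [a] is a nonzerodivisor modulo [K], having [a ^+ i * s] in [K] would put [s] in [K], hence in
    [P]; so [K] misses [power_mul a P]. *)
Lemma prime_below P K a : noetherian R -> prime_ideal P -> ideal K -> subI K P ->
  (forall r, K (a * r) -> K r) -> exists Q, [/\ prime_ideal Q, subI K Q, subI Q P & ~ Q a].
Proof.
move=> noeth primeP hK KP rega; have [hP [pP _]] := primeP.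
have [|||Q [primeQ KQ QS]] := @prime_avoiding K (power_mul a P) noeth hK.
- exact: power_mul1.
- by move=> c d; exact: power_mulM.
- move=> y hy [i [s [Ps yE]]]; apply: Ps; apply: KP; move: hy; rewrite yE {yE}.
  by elim: i => [|i IH]; rewrite ?expr0 ?mul1r // exprS -mulrA => /rega.
exists Q; split=> // [y Qy|Qa].
  apply: contrapT => Py; apply: (QS y Qy); exists 0%N, y.
  by rewrite expr0 mul1r.
by apply: (QS a Qa); exists 1%N, 1; rewrite expr1 mulr1.
Qed.

(* A prime containing [a, b] and different from [m] would sit on top of a chain of primes of
   length 2, hence strictly inside [m] a chain of length 3. *)
Lemma regular_pair_radical m a b : noetherian R -> local_ring m ->
  (forall p n, prime_chain (R := R) p n -> (n <= 2)%N) ->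
  m a -> m b -> regular_pair a b ->
  forall y, m y -> exists k, pairI a b (y ^+ k).
Proof.
move=> noeth loc dim ma mb [rega regb] y my; apply: contrapT => nk.
have primem := local_prime noeth loc; have [hm _] := primem.
have [|||Q [primeQ abQ Qy]] := @prime_avoiding (pairI a b)
    (fun z => exists k, z = y ^+ k) noeth (ideal_pair a b).
- by exists 0%N.
- by move=> _ _ [i ->] [j ->]; exists (i + j)%N; rewrite exprD.
- by move=> z h [k yk]; apply: nk; exists k; rewrite -yk.
have Qm : subI Q m by apply: ideal_proper_sub => //; case: primeQ => ? [].
have [||P1 [prime1 aP1 P1Q P1b]] := @prime_below Q (princ a) b noeth primeQ (ideal_princ a).
- by move=> z hz; apply: abQ; apply: addI_subl.
- by move=> r; rewrite mulrC; exact: regb.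
have [||P0 [prime0 _ P01 P0a]] := @prime_below P1 (@zeroI R) a noeth prime1 (ideal_zero R).
- by move=> _ ->; apply: ideal0; case: prime1.
- by move=> r; rewrite mulrC; exact: rega.
(* Strictness is witnessed by [a], [b] and [y]. The top member [m] of the chain is the default value
   of [nth], reached at index 3. *)
suff /dim : prime_chain (fun i => nth m [:: P0; P1; Q] i) 3 by [].
split; first by case=> [|[|[|[|]]]].
case=> [|[|[|i]]] // _; split=> //=.
- by move/(_ a (aP1 a (princ_id a))).
- by move/(_ b (abQ b (pair_r a b))).
- by move=> /(_ y my) /Qy; apply; exists 1%N; rewrite expr1.
Qed.

Lemma gen_pow_sub s Q : ideal Q -> (forall y, y \in s -> exists k, Q (y ^+ k)) ->
  exists k, subI (powI (gen s) k) Q.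
Proof.
move=> hQ; elim: s => [|g s IH] h.
  by exists 1%N; rewrite powI1 // gen_nil => _ ->; exact: ideal0.
have [i hi] := h g (mem_head _ _).
have [|j hj] := IH; first by move=> y ys; apply: h; rewrite inE ys orbT.
exists (i + j)%N; rewrite gen_cons => y.
move=> /(pow_addI (ideal_princ g) (ideal_gen s)) [c [d [hc /hj Qd ->]]].
apply: idealD => //; move: c hc; suff: subI (powI (princ g) i) (princ (g ^+ i)).
  by move=> k c /k; exact: princ_sub.
elim: i {hi} => [|i IHi]; first by move=> c _; exists c; rewrite ?expr0 ?mulr1.
apply: prodI_sub => // c _ /IHi [r _ ->] [t _ ->].
by exists (r * t) => //; rewrite exprSr; ring.
Qed.

Lemma pow_sub_radical I Q : noetherian R -> ideal I -> ideal Q ->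
  (forall y, I y -> exists k, Q (y ^+ k)) -> exists k, subI (powI I k) Q.
Proof.
move=> noeth hI hQ h; have [s sI] := noetherian_fg noeth hI.
rewrite sI; apply: gen_pow_sub => // y ys; apply: h.
by rewrite sI; exact: gen_mem.
Qed.

End Noetherian.

(** * Regular pairs and general elements *)

Section Generic.
Variable R : comNzRingType.
Implicit Types (A B C D I J K L M P Q X Y Z m : iset R) (a b r u x y z : R).

(* The annihilators of the elements [x + f i * y] are independent, so by the ascending chain
   condition one of them vanishes. *)
Lemma generic_nonzerodivisor m (f : nat -> R) x y : noetherian R -> local_ring m ->
  (forall i j, i <> j -> ~ m (f i - f j)) ->
  (forall r, r * x = 0 -> r * y = 0 -> r = 0) ->
  exists i, forall r, r * (x + f i * y) = 0 -> r = 0.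
Proof.
move=> noeth loc hf faithful.
pose N i := colonE (@zeroI R) (x + f i * y).
pose fix K n := if n is n'.+1 then addI (K n') (N n') else @zeroI R.
have hN i : ideal (N i) by apply: ideal_colonE.
have hK n : ideal (K n) by elim: n => [|n IH] /=; auto.
have indep n j r : (n <= j)%N -> K n r -> N j r -> r = 0.
  elim: n j r => [|n IH] j r nj //= [s [t [Ks Nt ->]]] Nst.
  (* Subtracting [t (x + f n y) = 0] from [(s + t) (x + f j y) = 0] puts [t (f j - f n) y] in [K n].
     It also lies in [N n], so it vanishes by induction; as [f j - f n] is a unit, [t y = 0], then
     [t x = 0], and [t = 0]. *)
  have t0 : t = 0.
    have [|v vf] := @local_unit _ m (f j - f n) noeth loc; first by apply: hf; lia.
    have wE : t * (f j - f n) * y = - (x + f j * y) * s.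
      move: Nst Nt; rewrite /N /colonE /zeroI => Nst Nt.
      have -> : t * (f j - f n) * y =
        (s + t) * (x + f j * y) - t * (x + f n * y) - (x + f j * y) * s by ring.
      by rewrite Nst Nt; ring.
    have w0 : t * (f j - f n) * y = 0.
      apply: (IH n _ (leqnn n)); first by rewrite wE; exact: ideal_mull.
      by rewrite -mulrA; exact: ideal_mulr.
    have ty : t * y = 0.
      have -> : t * y = v * (f j - f n) * (t * y) by rewrite vf mul1r.
      have -> : v * (f j - f n) * (t * y) = v * (t * (f j - f n) * y) by ring.
      by rewrite w0 mulr0.
    apply: faithful => //; move: Nt.
    by rewrite /N /colonE /zeroI mulrDr [t * (_ * _)]mulrCA ty mulr0 addr0.
  move: Nst; rewrite t0 !addr0; exact: (IH j s (ltnW nj) Ks).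
have [||n hn] := noeth K => //; first by move=> n; exact: addI_subl.
exists n => r hr; apply: (indep n n r (leqnn n)) => //.
by apply: (hn n.+1) => //; apply: addI_subr.
Qed.

(** If [r y] is in [(x)], then [r] multiplies [a] and [b] into [(x)]: [r a = s x] and [r b = t x].
    Cancelling [x] gives [s b = t a], so [s = u a], and cancelling [a] gives [r = u x]. *)
Lemma regular_pair_generators a b x y : regular_pair a b ->
  pairI x y a -> pairI x y b -> (forall r, r * x = 0 -> r = 0) -> regular_pair x y.
Proof.
move=> [rega regb] Ja Jb regx; split=> // r hry.
have hJ : subI (pairI x y) (colonE (princ x) r).
  apply: pair_sub; first by auto.
    by exists r => //; rewrite mulrC.
  by rewrite /colonE mulrC.
have [s _ sE] := hJ a Ja; have [t _ tE] := hJ b Jb.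
have /regb [u _ uE] : princ a (s * b).
  exists t => //; apply/eqP; rewrite -subr_eq0; apply/eqP/regx.
  have -> : (s * b - t * a) * x = (s * x) * b - (t * x) * a by ring.
  by rewrite -sE -tE; ring.
exists u => //; apply/eqP; rewrite -subr_eq0; apply/eqP/rega.
by rewrite mulrBl [r * a]mulrC sE uE; ring.
Qed.

Lemma regular_pair_pow a b i j : regular_pair a b -> regular_pair (a ^+ i) (b ^+ j).
Proof.
move=> [rega regb]; have regai k r : r * a ^+ k = 0 -> r = 0.
  elim: k => [|k IH]; first by rewrite expr0 mulr1.
  by rewrite exprSr mulrA => /rega.
split=> [r /regai|] //; have step k r : princ (a ^+ k) (r * b) -> princ (a ^+ k) r.
  elim: k r => [|k IH] r; first by exists r; rewrite ?expr0 ?mulr1.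
  case=> t _ tE; have /regb [s _ sE] : princ a (r * b).
    by exists (t * a ^+ k) => //; rewrite tE exprSr; ring.
  have [|u _ uE] := IH s.
    exists t => //; apply/eqP; rewrite -subr_eq0; apply/eqP/rega.
    by rewrite mulrBl mulrAC -sE tE exprSr; ring.
  by exists u => //; rewrite sE uE exprSr; ring.
elim: j => [|j IH] r; first by rewrite expr0 mulr1.
by rewrite exprSr mulrA => /step /IH.
Qed.

Lemma lenle_princ_mul L p q x y : ideal L ->
  lenle p (addI (princ x) L) (@unitI R) -> lenle q (addI (princ y) L) (@unitI R) ->
  lenle (p + q) (addI (princ (x * y)) L) (@unitI R).
Proof.
move=> hL hp hq; rewrite addnC.
have sub : subI (addI (princ (x * y)) L) (addI (princ x) L).
  apply: addI_mono => // _ [r _ ->]; exists (r * y) => //; ring.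
apply: (lenle_add (ideal_unit R) (B := addI (princ x) L)) => //; try by auto.
have -> : addI (princ x) L = addI (scaleI x (@unitI R)) (addI (princ (x * y)) L).
  apply: subI_antisym.
    apply: addI_min; [by auto|by apply: addI_subl; auto|].
    by move=> z Lz; do 2![apply: addI_subr; first by auto].
  by apply: addI_min; [auto|apply: addI_subl|].
apply/lenle_iso => //; first by auto.
rewrite cap_unitl; apply: lenle_bot hq; apply: addI_min; first by auto.
  by move=> _ [r _ ->]; apply: addI_subl => //; exists r => //; ring.
by move=> l Ll; apply: addI_subr => //; exact: ideal_mulr.
Qed.

Lemma lenle_princ_exp L p x n : ideal L ->
  lenle p (addI (princ x) L) (@unitI R) ->
  lenle (n * p) (addI (princ (x ^+ n)) L) (@unitI R).
Proof.
move=> hL hp; elim: n => [|n IH].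
  rewrite expr0 => y _; apply: addI_subl => //; by exists y; rewrite ?mulr1.
by rewrite exprS mulSn; exact: lenle_princ_mul.
Qed.

Lemma pairIC x y : pairI x y = pairI y x.
Proof. by apply: subI_antisym; apply: pair_sub; auto using pair_l, pair_r. Qed.

Lemma lenle_pair_exp p x y i j : lenle p (pairI x y) (@unitI R) ->
  lenle (j * (i * p)) (pairI (x ^+ i) (y ^+ j)) (@unitI R).
Proof.
move=> hp; rewrite pairIC; apply: lenle_princ_exp => //.
by rewrite -/(pairI _ _) pairIC; exact: lenle_princ_exp.
Qed.

(** An element already in [L] gives a relation by itself. Otherwise adjoining it to [L] lowers the
    length bound, and a relation modulo the larger ideal is corrected by one further coefficient. *)
Lemma linear_dependence (T : eqType) (s : seq T) (M : T -> R) n L A :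
  ideal L -> ideal A -> subI L A -> uniq s -> (forall t, t \in s -> A (M t)) ->
  lenle n L A -> (n < size s)%N ->
  exists c : T -> R, L (\sum_(t <- s) c t * M t) /\ exists2 t, t \in s & c t = 1.
Proof.
elim: s n L => [|t s IH] n L hL hA LA //= /andP[ts us] AM hn ltn.
have [LMt|nLMt] := pselect (L (M t)).
  exists (fun w => (w == t)%:R); split; last by exists t; rewrite ?mem_head ?eqxx.
  rewrite big_cons eqxx mul1r big_seq big1 ?addr0 // => w ws.
  by case: eqP ws ts => [-> ->|]; rewrite ?mul0r.
have AMt : A (M t) by apply: AM; rewrite mem_head.
case: n hn ltn => [|n] hn ltn; first by case: nLMt; exact: hn.
have hK : ideal (addI (princ (M t)) L) by auto.
have KA : subI (addI (princ (M t)) L) A by apply: addI_min => //; exact: princ_sub.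
have [|||c [[_ [l [[r _ ->] Ll E]]] [w ws cw]]] := IH n _ hK hA KA us.
- by move=> w ws; apply: AM; rewrite inE ws orbT.
- apply: hn => //; first exact: addI_subr.
  by move=> h; apply: nLMt; apply: h; apply: addI_subl => //; exact: princ_id.
- by [].
have neq v : v \in s -> (v == t) = false by case: eqP ts => // -> /negP.
exists (fun v => if v == t then - r else c v); split.
  rewrite big_cons eqxx (eq_big_seq (fun v => c v * M v)) => [|v vs]; last by rewrite neq.
  by rewrite E addrA mulNr addNr add0r.
by exists w; rewrite ?inE ?ws ?orbT ?neq.
Qed.

(** * Polynomials with values in a prime ideal *)

Section Nonvanishing.
Variables (m : iset R) (f : nat -> R).
Hypothesis (primem : prime_ideal m) (hf : forall i j, i <> j -> ~ m (f i - f j)).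

(** Dividing [q - q.[h 0]] by ['X - h 0] leaves [g], whose values at the remaining points lie in the
    prime [m] because [h k.+1 - h 0] does not. The induction on the size continues with the shifted
    sequence. *)
Lemma poly_vanishing (p : {poly R}) : (forall k, m p.[f k]) -> forall i, m p`_i.
Proof.
have [hm [pm mM]] := primem.
suff key n (h : nat -> R) (q : {poly R}) : (forall i j, i <> j -> ~ m (h i - h j)) ->
    (size q <= n)%N -> (forall k, m q.[h k]) -> forall i, m q`_i.
  exact: (key (size p) f).
elim: n h q => [|n IH] h q hh sq hq i.
  move: sq; rewrite leqn0 size_poly_eq0 => /eqP ->.
  by rewrite coef0; exact: ideal0.
have /factor_theorem [g gE] : root (q - q.[h 0%N]%:P) (h 0%N).
  by rewrite /root !hornerE subrr.
have qE : q = g * ('X - (h 0%N)%:P) + q.[h 0%N]%:P by rewrite -gE subrK.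
have sg : (size g <= n)%N.
  have [->|g0] := eqVneq g 0; first by rewrite size_poly0.
  rewrite -ltnS (_ : (size g).+1 = size (g * ('X - (h 0%N)%:P))).
    rewrite -gE (leq_trans (size_polyD _ _)) // geq_max sq size_polyN.
    by rewrite (leq_trans (size_polyC_leq1 _)).
  by rewrite size_Mmonic ?monicXsubC // size_XsubC addn2.
have mg : forall j, m g`_j.
  apply: (IH (fun k => h k.+1)) => // [j k jk|k]; first by apply: hh; lia.
  have := hq k.+1; rewrite qE !hornerE => mk.
  have /mM [//|] : m (g.[h k.+1] * (h k.+1 - h 0%N)).
    by rewrite -[X in m X](addrK q.[h 0%N]); apply: idealB.
  by move=> mh; case: (@hh k.+1 0%N).
rewrite qE coefD; apply: idealD => //.
  rewrite mulrBr coefB coefMX coefMC; apply: idealB => //.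
    by case: eqP => // _; exact: ideal0.
  exact: ideal_mulr.
by rewrite coefC; case: eqP => // _; exact: ideal0.
Qed.

Lemma sum_vanishing n (c : nat -> R) :
  (forall k, m (\sum_(i < n) c i * f k ^+ i)) -> forall i, (i < n)%N -> m (c i).
Proof.
move=> h i lt_in; have := @poly_vanishing (\poly_(i < n) c i) _ i.
rewrite coef_poly lt_in; apply => k.
by rewrite horner_poly.
Qed.

Lemma sum2_vanishing n (c : nat -> nat -> R) :
  (forall k l, m (\sum_(i < n) \sum_(j < n) c i j * (f k ^+ i * f l ^+ j))) ->
  forall i j, (i < n)%N -> (j < n)%N -> m (c i j).
Proof.
move=> h i j lt_in lt_jn; apply: (@sum_vanishing n (c i)) => // l.
apply: (@sum_vanishing n (fun i => \sum_(j < n) c i j * f l ^+ j)) => // k.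
rewrite [X in m X](_ : _ = \sum_(i < n) \sum_(j < n) c i j * (f k ^+ i * f l ^+ j)) //.
by apply: eq_bigr => i' _; rewrite mulr_suml; apply: eq_bigr => j' _; ring.
Qed.
End Nonvanishing.

End Generic.

(** Increments of at least [(d + 2) ^ 2] from every [2 d + 2] to [2 d + 3] would force cubic growth.
    It is applied to the Hilbert-Samuel function, with [(d + 2) ^ 2] counting monomials. *)
Lemma quadratic_gap (H : nat -> nat) c : (forall n, (H n <= H n.+1)%N) ->
  (forall n, (H n <= c * n ^ 2)%N) ->
  exists d, (H (2 * d).+3 < H (2 * d).+2 + d.+2 ^ 2)%N.
Proof.
move=> Hmono Hc; apply: contrapT => ngap.
have gap d : (H (2 * d).+2 + d.+2 ^ 2 <= H (2 * d).+3)%N.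
  by rewrite leqNgt; apply/negP => h; apply: ngap; exists d.
have cubic d : (d ^ 3 <= 3 * H (2 * d).+2)%N.
  elim: d => [|d IH] //.
  have := gap d; have := Hmono (2 * d).+3; rewrite (_ : (2 * d.+1).+2 = (2 * d).+4); last lia.
  by rewrite !expnS !expn0 in IH *; nia.
(* With [D = 48 c + 1] one gets [D ^ 3 <= 3 c (2 D + 2) ^ 2 <= 48 c D ^ 2 = (D - 1) D ^ 2], which is
   absurd. *)
have := cubic (48 * c).+1; have := Hc (2 * (48 * c).+1).+2.
move: (H _) => h; set D := (48 * c).+1 => h1 h2.
have D1 : (48 * c = D - 1)%N by rewrite /D; lia.
have : (16 * (D ^ 3) <= 16 * (3 * (c * (2 * D).+2 ^ 2)))%N by lia.
have : ((2 * D).+2 ^ 2 <= 16 * D ^ 2)%N by rewrite /D !expnS; nia.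
rewrite !expnS !expn0; nia.
Qed.

(** * Minimal reductions are generated by two elements *)

Section Reductions.
Variable R : comNzRingType.
Implicit Types (A B C D I J K L M P Q X Y Z m : iset R) (a b r u x y z : R).

Lemma reduction_stable J I n k : ideal I -> prodI J (powI I n) = powI I n.+1 ->
  (n <= k)%N -> prodI J (powI I k) = powI I k.+1.
Proof.
move=> hI h /subnKC <-; rewrite -addSn !powD // -prodI_assoc h //.
Qed.

Lemma reduction_powJ J I n p : ideal I -> prodI J (powI I n) = powI I n.+1 ->
  prodI (powI J p) (powI I n) = powI I (p + n).
Proof.
move=> hI h; elim: p => [|p IH]; first by rewrite prod_unitI.
rewrite powS [prodI _ J]prodI_comm prodI_assoc IH.
by apply: (reduction_stable hI h); exact: leq_addl.
Qed.

Lemma pow_add_princ J K z n : ideal J -> ideal K -> subI K J -> J z ->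
  subI J (addI K (princ z)) ->
  subI (powI J n.+1) (addI (prodI K (powI J n)) (princ (z ^+ n.+1))).
Proof.
move=> hJ hK KJ Jz JKz; elim: n => [|n IH].
  by rewrite powI1 // expr1 prodI_comm prod_unitI.
rewrite powS; apply: prodI_sub => [|a b Ja Jb]; first by auto.
have [b' [_ [Kb' [s _ ->] ->]]] := JKz b Jb.
have [t [_ [ht [q _ ->] aE]]] := IH a Ja.
have e : a * (b' + s * z) = b' * a + t * (s * z) + q * s * z ^+ n.+2.
  by rewrite mulrDr {2}aE !exprS; ring.
exists (b' * a + t * (s * z)), (q * s * z ^+ n.+2); split=> //; last by exists (q * s).
apply: (idealD (ideal_prod _ _)); first exact: prodI_mul.
by rewrite powS -prodI_assoc; apply: prodI_mul => //; exact: ideal_mull.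
Qed.

Section Descent.
Variables (m I : iset R) (f : nat -> R).
Hypotheses (noeth : noetherian R) (loc : local_ring m) (hI : ideal I).
Hypothesis hf : forall i j, i <> j -> ~ m (f i - f j).

(** Factors [z1] and [z2] are exchanged one at a time for [al z3] and [be z3]; each exchange costs
    an element of [K J^n]. *)
Lemma monomial_congruence J K z1 z2 z3 (al be : R) n i j e : ideal J ->
  J z1 -> J z2 -> J z3 -> K (z1 - al * z3) -> K (z2 - be * z3) ->
  (i + j + e = n.+1)%N ->
  prodI K (powI J n) (z1 ^+ i * z2 ^+ j * z3 ^+ e - al ^+ i * be ^+ j * z3 ^+ n.+1).
Proof.
move=> hJ J1 J2 J3 K1 K2; elim: i j e => [|i IHi] j e.
  elim: j e => [|j IHj] e ije.
    by rewrite -ije !add0n !expr0 !mul1r subrr; exact: ideal0.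
  have -> : z1 ^+ 0 * z2 ^+ j.+1 * z3 ^+ e - al ^+ 0 * be ^+ j.+1 * z3 ^+ n.+1 =
     (z2 - be * z3) * (z2 ^+ j * z3 ^+ e) +
     be * (z1 ^+ 0 * z2 ^+ j * z3 ^+ e.+1 - al ^+ 0 * be ^+ j * z3 ^+ n.+1).
    by rewrite !expr0 !exprS; ring.
  apply: (idealD (ideal_prod _ _)); last by apply: (ideal_mull _ (ideal_prod _ _)); apply: IHj; lia.
  apply: prodI_mul => //; have -> : n = (j + e)%N by lia.
  by apply: powD_mul => //; exact: pow_exp.
move=> ije.
have -> : z1 ^+ i.+1 * z2 ^+ j * z3 ^+ e - al ^+ i.+1 * be ^+ j * z3 ^+ n.+1 =
   (z1 - al * z3) * (z1 ^+ i * z2 ^+ j * z3 ^+ e) +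
   al * (z1 ^+ i * z2 ^+ j * z3 ^+ e.+1 - al ^+ i * be ^+ j * z3 ^+ n.+1).
  by rewrite !exprS; ring.
apply: (idealD (ideal_prod _ _)); last by apply: (ideal_mull _ (ideal_prod _ _)); apply: IHi; lia.
apply: prodI_mul => //; have -> : n = (i + j + e)%N by lia.
by apply: powD_mul => //; [apply: powD_mul => //|]; exact: pow_exp.
Qed.

(* The [(d+2)^2] monomials [z1^i z2^j z3^(2d+2-i-j)] are linearly dependent modulo
   [m I^(2d+2)]; evaluating the relation at a point [(al, be, 1)] where it does not vanish
   shows that [z3^(2d+2)] is redundant once [z1], [z2] are replaced by [z1 - al z3],
   [z2 - be z3]. *)
Lemma reduction_descent d p z1 z2 z3 s :
  lenle p (prodI m (powI I (2 * d).+2)) (powI I (2 * d).+2) -> (p < d.+2 ^ 2)%N ->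
  reduction (gen [:: z1, z2, z3 & s]) I ->
  exists y1 y2, reduction (gen [:: y1, y2 & s]) I /\
    subI (gen [:: y1, y2 & s]) (gen [:: z1, z2, z3 & s]).
Proof.
move=> hp ltp; set J := gen [:: z1, z2, z3 & s] => -[hJ [JI [n /eqI_eq redJ]]].
have primem := local_prime noeth loc; have [hm [pm mM]] := primem.
have [J1 [J2 J3]] : J z1 /\ J z2 /\ J z3.
  by split; [|split]; apply: gen_mem; rewrite !inE eqxx ?orbT.
set N := (2 * d).+2 in hp *.
pose T : finType := ('I_d.+2 * 'I_d.+2)%type.
(* As [t.1] and [t.2] are at most [d + 1], the subtraction is not truncated and every monomial has
   degree [N]. *)
pose mon (t : T) := z1 ^+ t.1 * z2 ^+ t.2 * z3 ^+ (N - (t.1 + t.2)).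
have ltN (t : T) : (t.1 + t.2 + (N - (t.1 + t.2)) = N)%N.
  by have := ltn_ord t.1; have := ltn_ord t.2; rewrite /N; lia.
have monI t : t \in enum T -> powI I N (mon t).
  move=> _; apply: (@pow_mono _ _ _ _ JI); rewrite -(ltN t).
  by apply: powD_mul => //; [apply: powD_mul => //|]; exact: pow_exp.
have [||c [rel [t0 _ ct0]]] := linear_dependence (ideal_prod _ _) (ideal_pow I N) _
    (enum_uniq T) monI hp.
- exact: prodI_subr.
- by rewrite -cardE card_prod !card_ord mulnn.
pose g al be := \sum_(i < d.+2) \sum_(j < d.+2) c (i, j) * (al ^+ i * be ^+ j).
(* The coefficient [c t0 = 1] is not in [m], so the dehomogenized relation cannot take values in [m]
   at all points [(f k, f l)]. *)
have [k [l ngm]] : exists k l, ~ m (g (f k) (f l)).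
  apply: contrapT => nkl; pose c' i j := c (inord i, inord j).
  have vanish k l : m (\sum_(i < d.+2) \sum_(j < d.+2) c' i j * (f k ^+ i * f l ^+ j)).
    apply: contrapT => h; apply: nkl; exists k, l => mg; apply: h.
    under eq_bigr do under eq_bigr do rewrite /c' !inord_val.
    exact: mg.
  have := sum2_vanishing primem hf vanish (ltn_ord t0.1) (ltn_ord t0.2).
  by rewrite /c' !inord_val -surjective_pairing ct0.
set al := f k in ngm; set be := f l in ngm.
exists (z1 - al * z3), (z2 - be * z3); set K := gen _.
have hK : ideal K by apply: ideal_gen.
have K1 : K (z1 - al * z3) by apply: gen_mem; rewrite mem_head.
have K2 : K (z2 - be * z3) by apply: gen_mem; rewrite !inE eqxx orbT.
have KJ : subI K J.
  apply: gen_sub => // y; rewrite !inE => /or3P[/eqP ->|/eqP ->|ys].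
  - by apply: (idealB hJ) => //; exact: (ideal_mull _ hJ).
  - by apply: (idealB hJ) => //; exact: (ideal_mull _ hJ).
  - by apply: gen_mem; rewrite !inE ys !orbT.
have JKz : subI J (addI K (princ z3)).
  have hKz : ideal (addI K (princ z3)) by auto.
  have K3 : addI K (princ z3) z3 by apply: addI_subr => //; exact: princ_id.
  apply: gen_sub => // y; rewrite !inE => /or4P[/eqP ->|/eqP ->|/eqP -> //|ys].
  - rewrite -[z1](subrK (al * z3)); apply: (idealD hKz); first exact: addI_subl.
    exact: (ideal_mull _ hKz).
  - rewrite -[z2](subrK (be * z3)); apply: (idealD hKz); first exact: addI_subl.
    exact: (ideal_mull _ hKz).
  - by apply: addI_subl => //; apply: gen_mem; rewrite !inE ys !orbT.
split=> //; split=> //; split; first by move=> y /KJ /JI.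
set TK := prodI K (powI J (2 * d).+1).
have hTK : ideal TK by apply: ideal_prod.
have hS : ideal (addI TK (prodI m (powI I N))) by auto.
(* Replacing each monomial of the relation by the congruent multiple of [z3 ^+ N] puts
   [g al be * z3 ^+ N] in [K J^(N-1) + m I^N], and [g al be] is a unit. *)
have z3N : addI TK (prodI m (powI I N)) (z3 ^+ N).
  have [v vg] := local_unit noeth loc ngm.
  rewrite -[_ ^+ _]mul1r -vg -mulrA; apply: (ideal_mull _ hS).
  have gE : g al be * z3 ^+ N = \sum_(t : T) c t * (al ^+ t.1 * be ^+ t.2 * z3 ^+ N).
    rewrite /g pair_bigA mulr_suml; apply: eq_bigr => -[i j] _ /=.
    by rewrite !mulrA.
  rewrite gE; pose diff (t : T) := c t * (mon t - al ^+ t.1 * be ^+ t.2 * z3 ^+ N).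
  exists (- \sum_(t : T) diff t), (\sum_(t <- enum T) c t * mon t).
  split=> //.
    apply: (idealN hTK); rewrite -big_enum; apply: ideal_sum => // t _.
    by apply: (ideal_mull _ (ideal_prod _ _)); apply: monomial_congruence => //; exact: ltN.
  rewrite big_enum /= addrC -sumrB; apply: eq_bigr => t _; rewrite /diff; ring.
have JN : subI (powI J N) (addI TK (prodI m (powI I N))).
  move=> y /(pow_add_princ hJ hK KJ J3 JKz) [t [_ [ht [r _ ->] ->]]].
  by apply: (idealD hS); [apply: addI_subl|exact: (ideal_mull _ hS)].
(* Now [I^(N+n) = J^N I^n] lies in [K I^(N-1+n) + m I^(N+n)], and Nakayama removes the last
   summand. *)
exists ((2 * d).+1 + n)%N.
suff h : subI (powI I ((2 * d).+1 + n).+1) (prodI K (powI I ((2 * d).+1 + n))).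
  move=> y; split; last exact: h.
  by rewrite powS prodI_comm; apply: prodI_mono => // z /KJ /JI.
apply: (nakayama noeth loc) => //.
rewrite -addSn -/N -{1}(reduction_powJ N hI redJ).
apply: prodI_sub => [|u w /JN [t [b [ht hb ->]]] Iw]; first by auto.
exists (t * w), (b * w); split; last by ring.
  apply: (@prodI_mono _ K (prodI (powI J (2 * d).+1) (powI I n)) _ _) => //.
    by rewrite (reduction_powJ _ hI redJ).
  by rewrite -prodI_assoc; exact: prodI_mul.
by rewrite powD // -prodI_assoc; exact: prodI_mul.
Qed.

(** While three generators remain, the descent yields a reduction inside [J] with one generator
    fewer, equal to [J] by minimality. Lists shorter than two are padded with zeros. *)
Lemma minimal_reduction_pair d p J :
  lenle p (prodI m (powI I (2 * d).+2)) (powI I (2 * d).+2) -> (p < d.+2 ^ 2)%N ->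
  minimal_reduction J I -> exists x y, J = pairI x y.
Proof.
move=> hp ltp [redJ minJ]; have [hJ _] := redJ.
have [s] := noetherian_fg noeth hJ.
have [n] := ubnP (size s); elim: n s => // n IH s lt_s JE.
case: s lt_s JE => [|z1 [|z2 [|z3 s]]] lt_s JE.
- exists 0, 0; rewrite JE gen_nil; apply: subI_antisym; last exact: pair_sub.
  by move=> _ ->; apply: ideal0.
- exists z1, 0; rewrite JE gen_cons gen_nil; congr (addI _ _).
  apply: subI_antisym; first by move=> _ ->; apply: ideal0.
  by apply: princ_sub.
- exists z1, z2; rewrite JE !gen_cons gen_nil; congr (addI _ _).
  apply: subI_antisym; last by apply: addI_subl.
  by apply: addI_min => // _ ->; apply: ideal0.
have redJ' := redJ; rewrite JE in redJ'.
have [y1 [y2 [redK KJ]]] := reduction_descent hp ltp redJ'.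
apply: (IH [:: y1, y2 & s]) => //; apply/esym/eqI_eq; apply: minJ => //.
by rewrite JE.
Qed.

End Descent.
End Reductions.

(** * Second differences and the postulation number *)

Lemma poly_eventually0 (Q : {poly rat}) N :
  (forall n : nat, (N <= n)%N -> Q.[n%:R] = 0) -> Q = 0.
Proof.
move=> h; apply/eqP; apply: contraT => Q0.
pose rs := [seq n%:R : rat | n <- iota N (size Q)].
have := max_poly_roots (rs := rs) Q0; rewrite size_map size_iota ltnn; apply.
  apply/allP => _ /mapP [n + ->]; rewrite mem_iota => /andP [Nn _].
  by apply/rootP; exact: h.
by rewrite map_inj_uniq ?iota_uniq //; move=> i j /eqP; rewrite eqr_nat => /eqP.
Qed.

Section Numerical.
Variables (H v w : nat -> nat) (e r rho : nat) (P : {poly rat}) (N : nat).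
Hypotheses (H0 : H 0%N = 0%N) (PH : forall n : nat, (N <= n)%N -> P.[n%:R] = (H n)%:R).
Hypothesis recH : forall n, (H n.+1 + H n.-1 + v n = 2 * H n + e + w n)%N.
Hypothesis v0 : forall n, (r <= n)%N -> v n = 0%N.
Hypothesis w0 : forall n, (rho < n)%N -> w n = 0%N.

Let err (t : int) : rat := P.[t%:~R] - (Hz H t)%:R.

(** The recursion gives this at all large integers, hence as an identity of polynomials. *)
Lemma second_difference_const (t : rat) : P.[t + 1] - 2 * P.[t] + P.[t - 1] = e%:R.
Proof.
pose Q := (P \Po ('X + 1)) - 2%:P * P + (P \Po ('X - 1)) - e%:R%:P.
suff : Q = 0.
  move/(congr1 (fun q : {poly rat} => q.[t])); rewrite /Q !hornerE !horner_comp !hornerE.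
  by move/eqP; rewrite subr_eq0 => /eqP.
apply: (@poly_eventually0 _ (maxn r (maxn rho N)).+2) => n hn.
rewrite /Q !hornerE !horner_comp !hornerE.
case: n hn => [|n] // hn.
have -> : n.+1%:R + 1 = n.+2%:R :> rat by rewrite -[RHS]natr1.
have -> : n.+1%:R - 1 = n%:R :> rat by rewrite -natr1 addrK.
rewrite !PH; try lia.
have := recH n.+1; rewrite v0 ?w0 //=; try lia.
rewrite !addn0 => /(congr1 (fun k => k%:R : rat)).
rewrite (natrD _ (H n.+2)) (natrD _ (2 * _)) natrM => E.
by rewrite -[(H n)%:R](addKr (H n.+2)%:R) E; ring.
Qed.

Lemma err_rec (n : nat) :
  err (n%:Z + 1) - 2 * err n%:Z + err (n%:Z - 1) = (v n)%:R - (w n)%:R.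
Proof.
(* At [n = 0] the truncated predecessor yields [H 0 = 0], which is also the value of [Hz H] at
   [-1]. *)
have HzE : Hz H (n%:Z - 1) = H n.-1.
  by case: n => [|n]; [rewrite /= H0|rewrite (_ : n.+1%:Z - 1 = n%:Z) //; lia].
have -> : n%:Z + 1 = n.+1%:Z by lia.
have := second_difference_const n%:R; rewrite /err HzE /= => D.
have := congr1 (fun k => k%:R : rat) (recH n).
rewrite (natrD _ (_ + _)) (natrD _ (H n.+1)) (natrD _ (_ + _)) (natrD _ (2 * _)) natrM => E.
have -> : (n%:Z - 1)%:~R = n%:R - 1 :> rat by rewrite rmorphB.
have -> : n.+1%:Z%:~R = n%:R + 1 :> rat by rewrite natr1.
have -> : n%:Z%:~R = n%:R :> rat by [].
have -> : (v n)%:R = 2 * (H n)%:R + e%:R + (w n)%:R - (H n.+1)%:R - (H n.-1)%:R :> rat.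
  by rewrite -E; ring.
by rewrite -D; ring.
Qed.

(** Descending induction: the recursion at [n] determines the error at [n - 1] from those at [n] and
    [n + 1], so the vanishing reaches one place below [M]. *)
Lemma err_vanish M : (forall n, (M <= n)%N -> v n = w n) ->
  forall t : int, M%:Z - 1 <= t -> err t = 0.
Proof.
move=> vw; have key k n : (M <= n)%N -> (N < n + k)%N -> err (n%:Z - 1) = 0.
  elim: k n => [|k IH] n Mn Nn.
    case: n Mn Nn => [|n] // _; rewrite addn0 ltnS => Nn.
    rewrite (_ : n.+1%:Z - 1 = n%:Z); last lia.
    rewrite /err /= (_ : n%:Z%:~R = n%:R) // PH // subrr //.
  have e1 : err n%:Z = 0.
    by rewrite (_ : n%:Z = n.+1%:Z - 1); [apply: IH; lia|lia].
  have e2 : err (n%:Z + 1) = 0.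
    by rewrite (_ : n%:Z + 1 = n.+2%:Z - 1); [apply: IH; lia|lia].
  by have := err_rec n; rewrite e1 e2 vw // mulr0 subr0 add0r subrr.
move=> t Mt; have [n tE] : exists n : nat, t = n%:Z - 1.
  by exists `|(t + 1)%R|%N; lia.
by rewrite tE; apply: (key N.+1); lia.
Qed.

Lemma postulation_bound (nI : int) :
  (0 < rho)%N -> ((1 < rho)%N -> (0 < w rho)%N) -> (forall n, (n <= 1)%N -> w n = 0%N) ->
  (forall t : int, nI < t -> P.[t%:~R] = (Hz H t)%:R) ->
  (forall n : int, (forall t : int, n < t -> P.[t%:~R] = (Hz H t)%:R) -> nI <= n) ->
  nI != rho%:Z - 1 -> nI + 2 <= r%:Z.
Proof.
move=> rho0 wrho w01 Pn nmin nI_rho.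
have bound M : (forall n, (M <= n)%N -> v n = w n) -> nI <= M%:Z - 2.
  move=> vw; apply: nmin => t ht; apply/eqP; rewrite -subr_eq0; apply/eqP.
  by apply: (err_vanish vw); lia.
have [r_rho|rho_r] := leqP r rho; last first.
  suff : nI <= r%:Z - 2 by lia.
  by apply: bound => n rn; rewrite v0 ?w0 //; exact: leq_trans rn.
(* If [rho = 1], every [w n] vanishes, so [v] and [w] still agree from [r] on. *)
have [rho1|rho1] := leqP rho 1.
  suff : nI <= r%:Z - 2 by lia.
  apply: bound => n rn; rewrite v0 //; have [n1|n1] := leqP n 1; first by rewrite w01.
  by rewrite w0 //; exact: leq_ltn_trans n1.
(* Here [r <= rho] and [1 < rho]. The error vanishes from [rho] on, so [nI <= rho - 1]; at [rho - 1]
   it is [- w rho], nonzero, which excludes [nI < rho - 1]. *)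
have vw n : (rho < n)%N -> v n = w n by move=> hn; rewrite v0 ?w0 //; lia.
have := bound _ vw; have e1 := err_vanish vw (t := rho%:Z).
have e2 := err_vanish vw (t := rho%:Z + 1).
have := err_rec rho; rewrite e1 ?e2 ?v0 //; try lia.
rewrite mulr0 subr0 !add0r => E le_nI.
have lt_nI : nI < rho%:Z - 1 by lia.
have := Pn _ lt_nI => /eqP; rewrite -subr_eq0 -/(err _) E oppr_eq0 pnatr_eq0.
by rewrite -leqn0 leqNgt wrho.
Qed.

End Numerical.

(** * Ratliff-Rush closure *)

Section RatliffRush.
Variable R : comNzRingType.
Implicit Types (A B C D I J K L M P Q X Y Z m : iset R) (a b r u x y z : R).

Lemma sub_ratliff_rush K : ideal K -> subI K (ratliff_rush K).
Proof.
move=> hK y Ky; exists 1%N; split=> // l hl.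
by rewrite mulrC; exact: prodI_mul.
Qed.

(** Put [q + 1 = n (s + 1)]. Then [q >= s], so [I^(q+1) = J I^q], and [y J I^q] lies in
    [I^(n+1+q) = (I^n)^(s+2)]. *)
Lemma colon_sub_ratliff_rush I J n s : ideal I -> (0 < n)%N ->
  prodI J (powI I s) = powI I s.+1 ->
  subI (colon (powI I n.+1) J) (ratliff_rush (powI I n)).
Proof.
move=> hI n0 redJ y hy; exists s.+1; split=> // l; rewrite !powM // => hl.
case E: (n * s.+1)%N => [|q]; first by move: E n0; lia.
have sq : (s <= q)%N by rewrite -ltnS -E leq_pmull.
move: l hl; rewrite E -(reduction_stable hI redJ sq) mulnS E.
suff: subI (prodI J (powI I q)) (colonE (powI I (n + q.+1)) y).
  by move=> h l /h; rewrite /colonE mulrC.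
apply: prodI_sub => [|c u Jc Iu]; first by auto.
rewrite /colonE addnS -addSn mulrC mulrA; apply: powD_mul => //; exact: hy.
Qed.

(** If [y (I^n)^k] lies in [(I^n)^(k+1)], then [y a I^(nk) I^k] lies in
    [I^(n(k+1)) I I^k = (I^(n+1))^(k+1)]. *)
Lemma ratliff_rush_mul I n y a : ideal I -> I a ->
  ratliff_rush (powI I n) y -> ratliff_rush (powI I n.+1) (y * a).
Proof.
move=> hI Ia [k [k0]]; rewrite /colon !powM // => hy; exists k; split=> //.
move=> l; rewrite !powM // => hl.
have -> : (n.+1 * k.+1 = n * k.+1 + 1 + k)%N by lia.
move: l hl; rewrite mulSn addnC powD //.
suff: subI (prodI (powI I (n * k)) (powI I k))
           (colonE (powI I (n * k.+1 + 1 + k)) (y * a)).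
  by move=> h l /h; rewrite /colonE mulrC.
apply: prodI_sub => [|c u hc hu]; first by auto.
rewrite /colonE (_ : _ * _ = y * c * a * u); last by ring.
by do 2![apply: powD_mul => //]; [exact: hy|rewrite powI1].
Qed.

Lemma colon_not_sub I J rho : ideal I -> subI J I -> rho_index I rho -> (1 < rho)%N ->
  ~ subI (colon (powI I rho) J) (powI I rho.-1).
Proof.
move=> hI JI [_ [stab rmin]] rho1 sub.
suff /rmin : rr_stable_from I rho.-1 by lia.
move=> n hn; have [lt_n|le_n] := ltnP n rho; last exact: stab.
have -> : n = rho.-1 by lia.
move=> y; split; last by apply: sub_ratliff_rush.
move=> hy; apply: sub => j /JI Ij.
by apply/(stab rho (leqnn _)); rewrite -(ltn_predK rho1); exact: ratliff_rush_mul.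
Qed.

(** Apply [len_pair_prod] to [I^n] and compute [l(R / J I^n)] both through [J] and through
    [I^(n+1)]. At [n = 0] the truncated predecessor makes [I^(n-1)] the unit ideal. *)
Lemma hilbert_recursion I J x y (n : nat) : ideal I -> subI J I ->
  (forall k, flen (powI I k) (@unitI R)) -> J = pairI x y -> regular_pair x y ->
  flen J (@unitI R) ->
  (len (powI I n.+1) (@unitI R) + len (powI I n.-1) (@unitI R) +
     len (prodI J (powI I n)) (powI I n.+1) =
   2 * len (powI I n) (@unitI R) + len J (@unitI R) +
     len (powI I n.-1) (colon (powI I n) J))%N.
Proof.
move=> hI JI fI JE reg fJ; have hJ : ideal J by rewrite JE.
have [] := len_pair_prod (ideal_pow I n) (fI n) reg; rewrite -JE => fJI eJI.
have JIJ : subI (prodI J (powI I n)) J by exact: prodI_subl.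
have fJIR : flen (prodI J (powI I n)) (@unitI R).
  by apply: (flen_add (ideal_unit R) hJ) fJI fJ; auto.
have JII : subI (prodI J (powI I n)) (powI I n.+1).
  by rewrite powS prodI_comm; exact: prodI_mono.
have e1 := len_add (ideal_unit R) hJ (ideal_prod _ _) JIJ (fun _ _ => Logic.I) fJIR.
have e2 := len_add (ideal_unit R) (ideal_pow I n.+1) (ideal_prod _ _) JII
  (fun _ _ => Logic.I) fJIR.
have sub : subI (powI I n.-1) (colon (powI I n) J).
  case: {eJI e1 e2 JII fJIR JIJ fJI} n => [|n] //= u hu j /JI Ij; exact: prodI_mul.
have e3 := len_add (ideal_unit R) (ideal_colon J (ideal_pow I n)) (ideal_pow I n.-1) sub
  (fun _ _ => Logic.I) (fI n.-1).
by lia.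
Qed.

(** [I^n] contains [a ^+ (i n)] and [b ^+ (j n)], and raising the two generators to these powers
    multiplies the bound [p] by at most [i n] and [j n]. *)
Lemma hilbert_quadratic_bound I a b i j p (n : nat) : ideal I ->
  I (a ^+ i) -> I (b ^+ j) -> lenle p (pairI a b) (@unitI R) ->
  (len (powI I n) (@unitI R) <= j * i * p * n ^ 2)%N.
Proof.
move=> hI Ia Ib hp; apply: len_le.
have -> : (j * i * p * n ^ 2 = j * n * (i * n * p))%N by rewrite expnS expn1; ring.
apply: lenle_bot (lenle_pair_exp (i * n) (j * n) hp).
by apply: pair_sub => //; rewrite exprM; exact: pow_exp.
Qed.

(** [J] has two generators [x], [y] and contains powers of [a] and [b], which still form a regular
    pair. Hence no nonzero element kills both [x] and [y], some [x + f k * y] is a nonzerodivisor,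
    and it may replace [x]. *)
Lemma minimal_reduction_regular m I J a b d p : noetherian R -> local_ring m ->
  infinite_residue_field m -> ideal I -> (forall y, m y -> exists k, I (y ^+ k)) ->
  m a -> m b -> regular_pair a b ->
  lenle p (prodI m (powI I (2 * d).+2)) (powI I (2 * d).+2) -> (p < d.+2 ^ 2)%N ->
  minimal_reduction J I ->
  exists x y, J = pairI x y /\ regular_pair x y.
Proof.
move=> noeth loc [f hf] hI radI ma mb reg hp ltp minJ.
have [x [y JE]] := minimal_reduction_pair noeth loc hI hf hp ltp minJ.
have [[hJ [JI [n /eqI_eq redJ]]] _] := minJ.
have radJ z : m z -> exists k, J (z ^+ k).
  move=> /radI [k Ik]; exists (k * n.+1)%N; rewrite exprM.
  by apply: (prodI_subl (B := powI I n) hJ); rewrite redJ; exact: pow_exp.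
have [i Ja] := radJ a ma; have [j Jb] := radJ b mb.
have regij := regular_pair_pow i j reg.
have [|k regk] := @generic_nonzerodivisor R m f x y noeth loc hf.
  move=> r rx ry; apply: regij.1; move: Ja; rewrite JE.
  suff: subI (pairI x y) (colonE (@zeroI R) r) by move=> h /h; rewrite /colonE mulrC.
  by apply: pair_sub; [auto|rewrite /colonE mulrC|rewrite /colonE mulrC].
exists (x + f k * y), y; have JE' : J = pairI (x + f k * y) y.
  have [hx hy] := (pair_l (x + f k * y) y, pair_r (x + f k * y) y).
  have hp' := ideal_pair (x + f k * y) y.
  rewrite JE; apply: subI_antisym; apply: pair_sub => //; try exact: pair_r.
    by have := idealB hp' hx (ideal_mull (f k) hp' hy); rewrite addrK.
  have hxy := ideal_pair x y; apply: (idealD hxy); first exact: pair_l.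
  by apply: (ideal_mull _ hxy); exact: pair_r.
by split=> //; apply: regular_pair_generators regij _ _ regk; rewrite -JE'.
Qed.

End RatliffRush.

(** * The inequality between the postulation and reduction numbers *)

Theorem theorem3p4 (R : comNzRingType) (m I : iset R) (x : R)
  (nI : int) (rho r : nat) :
  noetherian R -> local_ring m -> krull_dim R 2 -> cohen_macaulay m 2 ->
  infinite_residue_field m -> m_primary m I -> superficial x I ->
  postulation_number I nI -> rho_index I rho -> reduction_number I r ->
  nI != rho%:Z - 1 -> nI + 2 <= r%:Z.
Proof.
move=> noeth loc [_ dim] [xs [sz [mxs regxs]]] inf [hI radI] _.
case=> H [P [hilbH [[N PN] [Pn nmin]]]] hrho [[J [minJ [/eqI_eq redJ _]]] _].
case: xs sz mxs regxs => [|a [|b []]] // _ mxs /regular_sequence_pair reg.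
have [ma mb] : m a /\ m b by split; apply: mxs; rewrite !inE eqxx ?orbT.
have Im : subI I m by move=> y Iy; apply/radI; exists 1%N.
have fI k : flen (powI I k) (@unitI R) by case: (ilength_len (ideal_pow I k) (hilbH k)).
have HE k : H k = len (powI I k) (@unitI R).
  by case: (ilength_len (ideal_pow I k) (hilbH k)).
have [k Ikab] := pow_sub_radical noeth hI (ideal_pair a b)
  (fun y Iy => regular_pair_radical noeth loc dim ma mb reg (Im y Iy)).
have [p hp] := flen_bot Ikab (fI k).
have [i Ia] := (radI a).1 ma; have [j Ib] := (radI b).1 mb.
(* As [I^(N+1)] lies in [m I^N], such a gap at [N = 2 d + 2] keeps the length of [I^N / m I^N] below
   the number of monomials used in the descent. *)
have [d gap] : exists d, (H (2 * d).+3 < H (2 * d).+2 + d.+2 ^ 2)%N.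
  apply: (@quadratic_gap H (j * i * p)%N) => n; rewrite !HE.
    by apply: len_bot (fI n.+1); exact: pow_anti.
  exact: (hilbert_quadratic_bound n hI Ia Ib hp).
have [x1 [y1 [JE regJ]]] : exists x y, J = pairI x y /\ regular_pair x y.
  apply: (minimal_reduction_regular noeth loc inf hI _ ma mb reg _ _ minJ).
  - by move=> y /radI.
  - apply: lenle_bot (lenle_len (flen_top (D := powI I (2 * d).+2) _ (fI (2 * d).+3))) => //.
    by rewrite powS prodI_comm; apply: prodI_mono.
  have := len_add (ideal_unit R) (ideal_pow I (2 * d).+2) (ideal_pow I (2 * d).+3)
    (pow_anti hI (leqnSn _)) (fun _ _ => Logic.I) (fI (2 * d).+3).
  by move: gap; rewrite !HE; lia.
have [[hJ [JI _]] _] := minJ.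
have fJ : flen J (@unitI R).
  by apply: flen_bot (fI r.+1); rewrite -redJ; exact: prodI_subl.
have [rho0 [stab _]] := hrho.
pose v n := len (prodI J (powI I n)) (powI I n.+1).
pose w n := len (powI I n.-1) (colon (powI I n) J).
have fw n : flen (powI I n.-1) (colon (powI I n) J) by apply: flen_top (fI n.-1).
apply: (@postulation_bound H v w (len J (@unitI R)) r rho P N) => //.
- by rewrite HE; apply/len_eq0.
- by move=> n; rewrite !HE; exact: (hilbert_recursion n hI JI fI JE regJ fJ).
- move=> n rn; have e := reduction_stable hI redJ rn.
  by apply/len_eq0; rewrite e //; exact: flen_top (fI n.+1).
- case=> [|n] // lt_n; apply/(len_eq0 (fw n.+1)) => y hy /=.
  apply/(stab n lt_n); apply: colon_sub_ratliff_rush redJ _ hy => //.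
  exact: leq_trans rho0 lt_n.
- move=> rho1; rewrite lt0n; apply/eqP => /(len_eq0 (fw rho)).
  exact: colon_not_sub.
(* For [n <= 1] the ideal [I^(n-1)] is the unit ideal. *)
- by case=> [|[|n]] // _; apply/len_eq0.
Qed.
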